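(* Suppose $0<r\le q<s<\infty$ and $r\le 1$. Let $(\Omega,\mu)$ be a $\sigma$-finite measure space with $\mu\ne0$, let $Y$ be an $r$-Banach space, and let $T:L_s(\mu)\to Y$ be a bounded linear operator. Define $t$ by $1/t=1/q-1/s$. Then the following conditions are equivalent: (i) There is a constant $C_1$ so that for any disjointly supported $f_1,\dots,f_n\in L_s(\mu)$, $\bigl(\sum_{i=1}^n\|Tf_i\|^q\bigr)^{1/q}\le C_1\bigl\|\sum_{i=1}^n|f_i|\bigr\|_{L_s(\mu)}$. (ii) There are a constant $C_2$ and a probability measure $\lambda$ on $\Omega$ so that for any $f\in L_s(\mu)$ and any measurable set $E$, $\|T(f\chi_E)\|\le C_2\|f\|_{L_s(\mu)}\,\lambda(E)^{1/q-1/s}$. (iii) There are a constant $C_3$ and a probability measure $\lambda$ on $\Omega$ so that for any $f\in L_s(\mu)$ and any real-valued measurable function $g$ on $\Omega$ with $|g|\le1$, $\|T(fg)\|\le C_3\|f\|_{L_s(\mu)}\,\|g\|_{L_{t,r}(\lambda)}$. (iv) There are a constant $C_4$ and $w\in L_1(\mu)$ with $w\ge0$ and $\int w\,d\mu=1$ such that for all $f\in L_s(\mu)$, $\|Tf\|\le C_4\|fw^{-1/s}\|_{L_{q,r}(w\mu)}$.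
   Context: Probability measures $\lambda$ on $\Omega$ are defined on the $\sigma$-algebra of $(\Omega,\mu)$. $w\mu$ is the measure $E\mapsto\int_E w\,d\mu$; the function $fw^{-1/s}$ is defined $w\mu$-almost everywhere. An $r$-Banach space ($0<r\le1$) is a quasi-Banach space whose quasi-norm satisfies $\|x+y\|^r\le\|x\|^r+\|y\|^r$. For a finite measure $\nu$ and $0<a,r<\infty$ the (possibly infinite) Lorentz quasi-norm is $$\|f\|_{L_{a,r}(\nu)}=\Bigl(\int_0^\infty\frac ra\,t^{r/a-1}f^*(t)^r\,dt\Bigr)^{1/r},\qquad f^*(t)=\inf_{\nu(E)\le t}\ \sup_{\omega\notin E}|f(\omega)|,$$ where $f^*$ is the decreasing rearrangement of $|f|$ (the infimum is over measurable sets $E$, and the supremum over the empty set is $0$). *)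

(* Defs.v *)
From HB Require Import structures.
From mathcomp Require Import all_boot all_order all_algebra.
From mathcomp Require Import all_classical all_reals all_analysis.
Set Implicit Arguments.
Unset Strict Implicit.
Unset Printing Implicit Defensive.
Import Order.TTheory GRing.Theory Num.Theory.
Import numFieldNormedType.Exports.
Local Open Scope classical_set_scope.
Local Open Scope ring_scope.

Record is_quasi_norm (R : realType) (Y : lmodType R) (N : Y -> R) : Prop :=
  IsQuasiNorm {
    qnorm_ge0 : forall y, 0 <= N y;
    qnorm_eq0 : forall y, N y = 0 -> y = 0;
    qnormZ : forall a y, N (a *: y) = `|a| * N y;
    qnormD : exists K : R, forall y z, N (y + z) <= K * (N y + N z) }.

Definition complete_for (R : realType) (Y : lmodType R) (N : Y -> R) : Prop :=
  forall u : nat -> Y,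
    (forall e : R, 0 < e ->
       exists n0, forall m n, (n0 <= m)%N -> (n0 <= n)%N -> N (u m - u n) < e) ->
    exists l : Y, (fun n => N (u n - l)) @ \oo --> (0 : R).

Record is_r_Banach (R : realType) (r : R) (Y : lmodType R) (N : Y -> R) : Prop :=
  IsRBanach {
    rBanach_qnorm : is_quasi_norm N;
    rBanach_subadd : forall y z, N (y + z) `^ r <= N y `^ r + N z `^ r;
    rBanach_complete : complete_for N }.

(* An operator on L_s(mu) is given by its action on representatives: only the
   values of T on s-integrable functions matter, and they depend only on the
   almost-everywhere class.  The library's Lspace is a vector space only for
   s >= 1, whereas here s may be any positive real. *)
Record is_bounded_linear (d : measure_display) (X : measurableType d)
    (R : realType) (mu : {measure set X -> \bar R}) (s : R)
    (Y : lmodType R) (N : Y -> R) (T : (X -> R) -> Y) : Prop :=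
  IsBoundedLinear {
    bl_ae : forall f g, f \in Lfun mu s%:E -> g \in Lfun mu s%:E ->
      {ae mu, forall x, f x = g x} -> T f = T g;
    bl_linear : forall (a : R) f g,
      f \in Lfun mu s%:E -> g \in Lfun mu s%:E ->
      T (fun x => a * f x + g x) = a *: T f + T g;
    bl_bounded : exists M : R, forall f, f \in Lfun mu s%:E ->
      ((N (T f))%:E <= M%:E * 'N[mu]_s%:E [EFin \o f])%E }.

Definition weighted (d : measure_display) (X : measurableType d)
    (R : realType) (mu : {measure set X -> \bar R}) (w : X -> R)
    (E : set X) : \bar R :=
  (\int[mu]_(x in E) (w x)%:E)%E.

(* [maxe 0] implements the convention that the supremum over the empty set
   is 0; it changes nothing otherwise.  The supremum is a true one, not an
   essential one, but modifying f on a nu-null set does not change the rearrangement. *)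
Definition rearrangement (d : measure_display) (X : measurableType d)
    (R : realType) (nu : set X -> \bar R) (f : X -> R) (t : R) : \bar R :=
  ereal_inf [set maxe 0%E (ereal_sup [set (`|f x|)%:E | x in ~` E])
            | E in [set E : set X | measurable E /\ (nu E <= t%:E)%E]].

Definition lorentz_norm (d : measure_display) (X : measurableType d)
    (R : realType) (a r : R) (nu : set X -> \bar R) (f : X -> R) : \bar R :=
  ((\int[lebesgue_measure]_(t in `]0%R, +oo[)
      ((r / a * t `^ (r / a - 1))%:E * rearrangement nu f t `^ r)) `^ r^-1)%E.

(* Constants are taken positive so that C * +oo = +oo (the library has
   0 * +oo = 0); enlarging a constant is always harmless. *)
Section Conditions.
Context (d : measure_display) (X : measurableType d) (R : realType).
Context (mu : {measure set X -> \bar R}) (Y : lmodType R) (N : Y -> R).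
Context (T : (X -> R) -> Y).

Definition upper_estimate (q s : R) : Prop :=
  exists C : R, 0 < C /\
    forall (n : nat) (f : 'I_n -> X -> R),
      (forall i, f i \in Lfun mu s%:E) ->
      (forall i j, i != j -> {ae mu, forall x, f i x = 0 \/ f j x = 0}) ->
      (((\sum_(i < n) N (T (f i)) `^ q) `^ q^-1)%:E
        <= C%:E * 'N[mu]_s%:E [EFin \o (fun x => (\sum_(i < n) `|f i x|)%R)])%E.

Definition set_estimate (q s : R) : Prop :=
  exists (C : R) (lambda : probability X R), 0 < C /\
    forall (f : X -> R) (E : set X), f \in Lfun mu s%:E -> measurable E ->
      ((N (T (fun x => (f x * \1_E x)%R)))%:E
        <= C%:E * 'N[mu]_s%:E [EFin \o f] * lambda E `^ (q^-1 - s^-1))%E.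

Definition multiplier_estimate (r s t : R) : Prop :=
  exists (C : R) (lambda : probability X R), 0 < C /\
    forall f g : X -> R, f \in Lfun mu s%:E ->
      measurable_fun setT g -> (forall x, `|g x| <= 1) ->
      ((N (T (fun x => (f x * g x)%R)))%:E
        <= C%:E * 'N[mu]_s%:E [EFin \o f] * lorentz_norm t r lambda g)%E.

(* Where w = 0 the library sets w `^ (- s^-1) = 0; that set is null for the
   measure [weighted mu w]. *)
Definition factorization (q r s : R) : Prop :=
  exists (C : R) (w : X -> R), 0 < C /\
    [/\ mu.-integrable setT (EFin \o w), forall x, 0 <= w x,
        (\int[mu]_x (w x)%:E = 1)%E &
        forall f : X -> R, f \in Lfun mu s%:E ->
          ((N (T f))%:E
            <= C%:E * lorentz_norm q r (weighted mu w)
                        (fun x => (f x * w x `^ (- s^-1))%R))%E].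

End Conditions.

(* Main.v *)
From HB Require Import structures.
Require Import Defs.
From mathcomp Require Import all_boot all_order all_algebra.
From mathcomp Require Import all_classical all_reals all_analysis.
From mathcomp Require Import measurable_realfun.
From mathcomp Require Import ring lra.
Import Order.TTheory GRing.Theory Num.Theory.
Import numFieldNormedType.Exports.
Local Open Scope classical_set_scope.
Local Open Scope ring_scope.

(** Write phi(E) for the norm of T on functions supported in E, and let
    1/t = 1/q - 1/s.  All four conditions are related through the set
    estimate phi(E) <= C lambda(E)^(1/t), whose content is that phi^t is
    dominated by a measure.

    Sets and functions.  Given a function h and a measure nu, a function f is
    cut along the dyadic level sets of h.  The r-th power of the quasi-norm of
    Y is subadditive, so the r-th powers of the pieces add up, and the sum of
    the 2^(nr) nu(|h| > 2^n)^(r/a) is controlled by the r-th power of the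
    Lorentz quasi-norm of h ([lorentz_norm_dyadic_ge], [op_lorentz_le]).  With
    h = g, nu = lambda and a = t this turns the set estimate into the
    multiplier estimate; with h = f w^(-1/s), nu = w mu and a = q it turns it
    into the factorization.  Conversely the Lorentz quasi-norm of a function
    supported in E is controlled by a weak-type bound and by the measure of E
    ([lorentz_norm_le]), which leads back to the set estimate.  For the
    factorization lambda must have a density: T does not see mu-null sets, so
    the singular part of lambda can be discarded ([set_bound_density]).

    Disjoint sums.  The set estimate gives the upper estimate by Hoelder's
    inequality.  The converse is the heart of the matter.  The upper estimate,
    tested on suitably scaled functions, bounds the sum of phi(E_i)^t over
    disjoint sets ([op_size_disjoint]), and eta = phi^t is subadditive up to a
    constant.  These two properties already force a dominating measure.  An
    additive majorant exists once the sums of the c_j eta(E_j) are bounded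
    over all fractional packings, that is whenever the c_j 1_(E_j) add up to
    at most 1 ([additive_majorant]).  Such a bound follows from a random
    selection: keep each E_j independently with probability proportional to
    c_j, make the kept sets disjoint, and observe that what is lost is again a
    packing, of multiplicity quadratic in the factor of proportionality
    ([finite_packing_le]).  Finally the countably additive part of the
    majorant still dominates, because T is order continuous
    ([upper_set_bound]). *)

Set Implicit Arguments.
Unset Strict Implicit.
Unset Printing Implicit Defensive.

(** * Fractional packings of a finite set *)

Section FinitePacking.
Context (R : realType).

(** The law of the random subset H of I that contains each i with
    probability x i, independently. *)
Definition subset_prob (I : finType) (x : I -> R) (H : {set I}) : R :=
  \prod_i (if i \in H then x i else 1 - x i).

Lemma subset_prob_ge0 (I : finType) (x : I -> R) (H : {set I}) :
  (forall i, 0 <= x i <= 1) -> 0 <= subset_prob x H.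
Proof.
move=> x01; apply: prodr_ge0 => i _; have /andP[x0 x1] := x01 i.
by case: ifP; rewrite // subr_ge0.
Qed.

(** Both sides are the probability that the random subset contains D; the
    sum over all H is the expanded product of the sums x i + (1 - x i), in
    which the second summand is dropped for i in D. *)
Lemma sum_subset_prob (I : finType) (x : I -> R) (D : {set I}) :
  \sum_(H : {set I} | D \subset H) subset_prob x H = \prod_(i in D) x i.
Proof.
transitivity (\prod_i (x i + (if i \in D then 0 else 1 - x i))); last first.
  rewrite [RHS]big_mkcond; apply: eq_bigr => i _.
  by case: ifP => _; rewrite ?addr0 // addrC subrK.
rewrite (@bigA_distr R 0 1 *%R +%R I x (fun i => if i \in D then 0 else 1 - x i)).
rewrite big_mkcond; apply: eq_bigr => H _ /=.
case: ifPn => [DH|/subsetPn[i iD iH]].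
  apply: eq_bigr => i _; case: ifPn => // iH.
  by rewrite ifN //; apply: contra iH; exact: (fintype.subsetP DH).
by rewrite (bigD1 i) //= (negbTE iH) iD mul0r.
Qed.

Lemma sum_subset_prob1 (I : finType) (x : I -> R) :
  \sum_(H : {set I}) subset_prob x H = 1.
Proof.
have := sum_subset_prob x finset.set0; rewrite big_set0 => <-.
by apply: eq_bigl => H; rewrite finset.sub0set.
Qed.

Lemma sum_subset_prob_mem (I : finType) (x : I -> R) (i : I) :
  \sum_(H : {set I} | i \in H) subset_prob x H = x i.
Proof.
have := sum_subset_prob x [set i]%SET; rewrite finset.big_set1 => <-.
by apply: eq_bigl => H; rewrite finset.sub1set.
Qed.

Lemma sum_subset_prob_mem2 (I : finType) (x : I -> R) (i j : I) : i != j ->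
  \sum_(H : {set I} | (i \in H) && (j \in H)) subset_prob x H = x i * x j.
Proof.
move=> ij; have := sum_subset_prob x [set i; j]%SET.
rewrite finset.big_setU1 ?inE //= finset.big_set1 => <-.
by apply: eq_bigl => H; rewrite finset.subUset !finset.sub1set.
Qed.


(** A crude bound that grows with the set; it only serves to make the
    supremum in the next proof finite. *)
Lemma packing_mass_le_card (T : finType) (eta : {set T} -> R) (c : {set T} -> R) :
  (forall A, 0 <= eta A <= 1) -> eta finset.set0 = 0 ->
  (forall E, 0 <= c E) -> (forall y, \sum_(E : {set T} | y \in E) c E <= 1) ->
  \sum_E c E * eta E <= #|T|%:R.
Proof.
move=> eta01 eta0 c0 c1.
apply: (@le_trans _ _ (\sum_(E : {set T}) \sum_(y in E) c E)).
  apply: ler_sum => E _; have [->|/set0Pn[y yE]] := eqVneq E finset.set0.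
    by rewrite eta0 mulr0 sumr_ge0.
  rewrite (bigD1 y) //= -[leLHS]addr0 lerD ?sumr_ge0 //.
  by have /andP[_ ?] := eta01 E; rewrite ler_piMr.
rewrite (exchange_big_dep predT) //= -sum1_card natr_sum.
exact: ler_sum.
Qed.

(** Let S be the supremum of the left-hand side over all packings c. Keep
    each set E independently with probability e * c E, and order the kept
    sets. Every kept E splits into the part not met by the kept sets before
    it and the part that is met. The first parts are disjoint, so their
    eta-sum is at most 1. A point lies in the second part of E only if an
    earlier set through it is kept too, so on average the second parts cover
    each point at most e ^+ 2 times and contribute at most e ^+ 2 * S. As
    eta is subadditive up to K this gives e * S <= K * (1 + e ^+ 2 * S), and
    e = (2 * K)^-1 yields the bound, whatever the size of T. *)
Lemma finite_packing_le (T : finType) (eta : {set T} -> R) (K : R) :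
  1 <= K -> (forall A, 0 <= eta A) -> eta finset.set0 = 0 ->
  (forall A B : {set T}, (A :&: B)%SET = finset.set0 ->
     eta (A :|: B)%SET <= K * (eta A + eta B)) ->
  (forall (I : finType) (A : I -> {set T}),
     (forall i j, i != j -> (A i :&: A j)%SET = finset.set0) -> \sum_i eta (A i) <= 1) ->
  forall c : {set T} -> R, (forall E, 0 <= c E) ->
    (forall y, \sum_(E : {set T} | y \in E) c E <= 1) ->
  \sum_E c E * eta E <= 4 * K ^+ 2.
Proof.
move=> K1 eta_ge0 eta0 etaU etaD c0 c0_ge0 c0_le1.
have K0 : 0 < K by apply: lt_le_trans K1.
have eta_le1 A : eta A <= 1.
  by have := etaD unit (fun=> A); rewrite big_const card_unit /= addr0; apply=> -[] [].
have eta01 A : 0 <= eta A <= 1 by rewrite eta_ge0 eta_le1.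
pose pk (u : R) (c : {set T} -> R) := (forall E, 0 <= c E) /\
  (forall y, \sum_(E : {set T} | y \in E) c E <= u).
pose V : set R := [set v | exists2 c, pk 1 c & v = \sum_E c E * eta E].
have V_le v : V v -> v <= #|T|%:R.
  by move=> [c [? ?] ->]; exact: packing_mass_le_card.
have Vsup : has_sup V.
  split; first by exists (\sum_E c0 E * eta E), c0.
  by exists #|T|%:R => v; exact: V_le.
pose S := sup V.
have leS c : pk 1 c -> \sum_E c E * eta E <= S.
  by move=> pc; apply: (sup_upper_bound Vsup); exists c.
have leSu u c : 0 < u -> pk u c -> \sum_E c E * eta E <= u * S.
  move=> u0 [cge cle]; rewrite -ler_pdivrMl // mulr_sumr.
  under eq_bigr do rewrite mulrA.
  apply: leS; split=> [E|y]; first by rewrite mulr_ge0 // invr_ge0 ltW.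
  by rewrite -mulr_sumr ler_pdivrMl // mulr1.
pose e : R := (2 * K)^-1.
have e0 : 0 < e by rewrite invr_gt0 mulr_gt0.
have e1 : e <= 1 by rewrite invf_le1 ?mulr_gt0 //; lra.
have main c : pk 1 c -> \sum_E c E * eta E <= K / e + K * e * S.
  move=> [cge cle].
  (* A packing may give the empty set a weight above 1, hence the case
     distinction; on nonempty sets e * c E is a probability. *)
  pose x (E : {set T}) := if E == finset.set0 then 0 else e * c E.
  have x_ge0 E : 0 <= x E by rewrite /x; case: ifP => // _; rewrite mulr_ge0 // ltW.
  have x01 E : 0 <= x E <= 1.
    rewrite x_ge0 /= /x; case: ifPn => // /set0Pn[y yE].
    rewrite mulr_ile1 ?(ltW e0) // (le_trans _ (cle y)) // (bigD1 E) //=.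
    by rewrite lerDl sumr_ge0.
  have x_le y : \sum_(E : {set T} | y \in E) x E <= e.
    rewrite -[leRHS]mulr1; apply: le_trans (_ : e * \sum_(E : {set T} | y \in E) c E <= _).
      rewrite mulr_sumr ler_sum // => E _; rewrite /x; case: ifP => // _.
      by rewrite mulr_ge0 // ltW.
    by rewrite ler_wpM2l // ltW.
  pose P := subset_prob x.
  have P0 H : 0 <= P H by exact: subset_prob_ge0.
  pose before (H : {set {set T}}) (E : {set T}) : {set T} :=
    (\bigcup_(F in H | (enum_rank F < enum_rank E)%N) F)%SET.
  pose A (H : {set {set T}}) (E : {set T}) : {set T} := (E :\: before H E)%SET.
  pose B (H : {set {set T}}) (E : {set T}) : {set T} := (E :&: before H E)%SET.
  have etaAB (H : {set {set T}}) (E : {set T}) : eta E <= K * (eta (A H E) + eta (B H E)).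
    rewrite -{1}(finset.setID E (before H E)) finset.setUC; apply: etaU.
    apply/setP => y; rewrite !inE.
    by case: (y \in before H E); rewrite ?andbF.
  have sumA (H : {set {set T}}) : \sum_(E in H) eta (A H E) <= 1.
    apply: le_trans (etaD _ (fun E => if E \in H then A H E else finset.set0) _).
      rewrite big_mkcond; apply: ler_sum => E _; by case: ifP.
    move=> E F EF.
    case: ifPn => EH; last by rewrite finset.set0I.
    case: ifPn => FH; last by rewrite finset.setI0.
    wlog lt : E F EF EH FH / (enum_rank F < enum_rank E)%N => [wl|].
      have [|lt|/val_inj/enum_rank_inj eq] := ltngtP (enum_rank F) (enum_rank E).
      - exact: wl.
      - by rewrite finset.setIC wl // eq_sym.
      - by rewrite eq eqxx in EF.
    apply/setP => y; rewrite !inE; apply/negbTE/negP => /andP[/andP[nb _] /andP[_ yF]].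
    by move/negP: nb; apply; apply/finset.bigcupP; exists F => //; rewrite FH.
  (* The random second parts, gathered into one deterministic packing. *)
  pose c' (F : {set T}) := \sum_(H : {set {set T}}) \sum_(E in H | B H E == F) P H.
  have pkc' : pk (e ^+ 2) c'.
    split=> [F|y]; first by apply: sumr_ge0 => H _; exact: sumr_ge0.
    apply: (@le_trans _ _ (\sum_(E : {set T} | y \in E)
       \sum_(F : {set T} | (y \in F) && (F != E)) \sum_(H : {set {set T}} | (E \in H) && (F \in H)) P H)).
      rewrite /c' exchange_big /=.
      under [leRHS]eq_bigr do rewrite (exchange_big_dep predT) //=.
      rewrite [leRHS](exchange_big_dep predT) //=; apply: ler_sum => H _.
      rewrite (exchange_big_dep (mem H)) => [|F E _ /andP[]] //=.
      rewrite big_mkcond [leRHS]big_mkcond; apply: ler_sum => E _ /=.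
      case: ifPn => EH; last by case: ifP => // _; rewrite sumr_ge0.
      rewrite (eq_bigl (fun F : {set T} => (y \in F) && (F == B H E))); last first.
        by move=> F; rewrite EH eq_sym.
      rewrite big_mkcondl /= big_pred1_eq.
      case: ifPn => [|_]; last by case: ifP => // _; rewrite sumr_ge0.
      rewrite inE => /andP[-> /finset.bigcupP[F /andP[FH lt] yF]].
      rewrite (bigD1 F) /= ?lerDl ?sumr_ge0 // yF FH !andbT.
      by apply: contraTneq lt => ->; rewrite ltnn.
    apply: (@le_trans _ _ (\sum_(E : {set T} | y \in E) x E * e)); last first.
      by rewrite -mulr_suml expr2 ler_wpM2r // ltW.
    apply: ler_sum => E yE; apply: le_trans (ler_wpM2l (x_ge0 E) (x_le y)).
    rewrite mulr_sumr big_mkcondr /=; apply: ler_sum => F yF; case: ifPn => FE.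
      by rewrite sum_subset_prob_mem2 // eq_sym.
    by rewrite mulr_ge0.
  have sumB : \sum_(H : {set {set T}}) \sum_(E in H) P H * eta (B H E) <= e ^+ 2 * S.
    apply: le_trans (leSu _ _ _ pkc'); last by rewrite exprn_gt0.
    under [leRHS]eq_bigr do rewrite /c' mulr_suml.
    rewrite [leRHS]exchange_big /=; apply: ler_sum => H _.
    under [leRHS]eq_bigr do rewrite mulr_suml.
    rewrite [leRHS](exchange_big_dep (mem H)) => [|F E _ /andP[]] //=.
    apply: ler_sum => E EH; rewrite (eq_bigl (pred1 (B H E))) ?big_pred1_eq //.
    by move=> F /=; rewrite EH /= eq_sym.
  have : e * \sum_E c E * eta E <= K * (1 + e ^+ 2 * S).
    rewrite mulr_sumr (eq_bigr (fun E => \sum_(H : {set {set T}} | E \in H) P H * eta E)).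
      rewrite (exchange_big_dep predT) //=.
      apply: (@le_trans _ _ (K * (\sum_(H : {set {set T}}) (P H * \sum_(E in H) eta (A H E))
         + \sum_(H : {set {set T}}) \sum_(E in H) P H * eta (B H E)))).
        rewrite -big_split mulr_sumr; apply: ler_sum => H _ /=.
        rewrite mulr_sumr -big_split mulr_sumr; apply: ler_sum => E EH /=.
        by rewrite -mulrDr mulrCA ler_wpM2l.
      rewrite ler_wpM2l ?(ltW K0) // lerD //.
      rewrite -(sum_subset_prob1 x); apply: ler_sum => H _.
      by rewrite -[leRHS]mulr1 ler_wpM2l.
    move=> E _; rewrite -mulr_suml sum_subset_prob_mem /x mulrA.
    by case: eqP => // ->; rewrite eta0 !mulr0.
  rewrite mulrC -ler_pdivlMr // => /le_trans; apply.
  by rewrite le_eqVlt; apply/orP; left; apply/eqP; field; rewrite gt_eqF.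
have SK : S <= K / e + K * e * S.
  apply: ge_sup => [|v [c pc ->]]; last exact: main.
  by have [] := Vsup.
have S4 : S <= 4 * K ^+ 2.
  have eE : e = (2 * K)^-1 by [].
  have -> : 4 * K ^+ 2 = 2 * (K / e) by rewrite eE invrK; ring.
  have Ke : K * e = 2^-1 by rewrite eE; field; rewrite gt_eqF.
  rewrite Ke in SK; lra.
exact: le_trans (leS _ (conj c0_ge0 c0_le1)) S4.
Qed.

End FinitePacking.

(** * Additive majorants of set functions *)

Section Packing.
Context (d : measure_display) (X : measurableType d) (R : realType).
Implicit Types (p : seq (R * set X)) (eta : set X -> R).

(** A finite family of weighted sets is kept as a list, so that families can
    be concatenated and rescaled. *)
Definition packing_weight p (x : X) : R := \sum_(e <- p) e.1 * \1_(e.2) x.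

Definition packing_value eta p : R := \sum_(e <- p) e.1 * eta e.2.

Definition packing p (u : R) : Prop :=
  (forall e, e \in p -> 0 <= e.1 /\ measurable e.2) /\
  (forall x, packing_weight p x <= u).

(** Only finitely many unions of atoms matter for one packing. A point x is
    replaced by the set J x of the indices of the members that contain it;
    this pulls the finite set of all index sets back to X and reduces the
    claim to the finite case. *)
Lemma packing_le eta (K : R) :
  1 <= K -> (forall A, measurable A -> 0 <= eta A) -> eta set0 = 0 ->
  (forall A B, measurable A -> measurable B -> A `&` B = set0 ->
     eta (A `|` B) <= K * (eta A + eta B)) ->
  (forall n (A : 'I_n -> set X), (forall i, measurable (A i)) ->
     (forall i j, i != j -> A i `&` A j = set0) -> \sum_i eta (A i) <= 1) ->
  forall p, packing p 1 -> packing_value eta p <= 4 * K ^+ 2.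
Proof.
move=> K1 eta_ge0 eta0 etaU etaD p [pm pw].
pose m := size p; pose e (i : 'I_m) := tnth (in_tuple p) i.
have ep i : e i \in p by exact: mem_tnth.
pose J x : {set 'I_m} := [set i | `[< (e i).2 x >]]%SET.
pose pull (F : {set {set 'I_m}}) : set X := [set x | J x \in F].
have mpull F : measurable (pull F).
  rewrite (_ : pull F = \big[setU/set0]_(t in F)
     \big[setI/setT]_i (if i \in t then (e i).2 else ~` (e i).2)).
    apply: bigsetU_measurable => t _; apply: bigsetI_measurable => i _.
    by case: ifP => _; [|apply: measurableC]; have [] := pm _ (ep i).
  apply/seteqP; split=> x /=.
    move=> xF; rewrite -bigcup_seq_cond; exists (J x); first by rewrite /= mem_index_enum.
    rewrite -bigcap_seq => i _ /=; rewrite inE; case: ifPn => /asboolP //.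
  rewrite -bigcup_seq_cond => -[t /= /andP[_ tF]]; rewrite -bigcap_seq => xt.
  suff Jt : J x = t by rewrite /pull /= Jt.
  apply/setP => i; rewrite inE.
  have := xt i; rewrite /= mem_index_enum => /(_ isT).
  by case: ifPn => it xi; apply/asboolP.
(* Only index sets of actual points are admitted: the packing condition says
   nothing about the other ones. *)
pose E i : {set {set 'I_m}} := [set t : {set 'I_m} | (i \in t) && `[< exists x, J x = t >]]%SET.
have pullE i : pull (E i) = (e i).2.
  apply/seteqP; split=> x; rewrite /pull /= !inE; first by case/andP => /asboolP.
  by move=> xi; apply/andP; split; apply/asboolP => //; exists x.
pose c (F : {set {set 'I_m}}) := \sum_(i | E i == F) (e i).1.
have e0 i : 0 <= (e i).1 by have [] := pm _ (ep i).
have -> : packing_value eta p = \sum_F c F * eta (pull F).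
  rewrite /packing_value big_tnth (partition_big E predT) //=.
  apply: eq_bigr => F _; rewrite mulr_suml; apply: eq_bigr => i /eqP <-.
  by rewrite pullE.
apply: (@finite_packing_le R _ (eta \o pull)) => //=.
- by move=> A; exact: eta_ge0.
- rewrite (_ : pull _ = set0) //; apply/seteqP; split=> x //=; by rewrite /pull /= inE.
- move=> A B AB.
  have -> : pull (A :|: B)%SET = pull A `|` pull B.
    by apply/seteqP; split=> x; rewrite /pull /= inE => /orP.
  apply: etaU => //; apply/seteqP; split=> x //= -[xA xB].
  by have : J x \in (A :&: B)%SET by [rewrite inE xA xB]; rewrite AB inE.
- move=> I A AD.
  rewrite (reindex (@enum_val I predT)) /=; last first.
    by apply: onW_bij; exact: enum_val_bij.
  apply: etaD => // i j ij; apply/seteqP; split=> x //= -[xi xj].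
  have : J x \in (A (enum_val i) :&: A (enum_val j))%SET by rewrite inE; apply/andP.
  by rewrite AD ?inE // (inj_eq enum_val_inj).
- by move=> F; apply: sumr_ge0.
- move=> t.
  rewrite /c (exchange_big_dep predT) //=.
  have [[x xt]|nt] := pselect (exists x, J x = t); last first.
    rewrite big1 // => i _; rewrite big1 // => F /andP[tF /eqP EF].
    by move: tF; rewrite -EF inE => /andP[_ /asboolP].
  apply: le_trans (pw x); rewrite /packing_weight [leRHS]big_tnth; apply: ler_sum => i _.
  have [ti|ti] := boolP (t \in E i).
    rewrite (bigD1 (E i)) ?ti ?eqxx //= big1 ?addr0.
      by move: ti; rewrite inE -xt inE => /andP[/asboolP xi _]; rewrite indicE mem_set ?mulr1.
    by move=> F /andP[/andP[_ /eqP ->]]; rewrite eqxx.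
  rewrite big_pred0 ?mulr_ge0 // => F; apply/negbTE/negP => /andP[tF /eqP EF].
  by rewrite EF tF in ti.
Qed.


Lemma packing_weight_ge0 p x : (forall e, e \in p -> 0 <= e.1) ->
  0 <= packing_weight p x.
Proof.
by move=> p0; rewrite /packing_weight big_seq sumr_ge0 // => e ep; rewrite mulr_ge0 ?p0.
Qed.

Lemma packing_weight_cat p q x :
  packing_weight (p ++ q) x = packing_weight p x + packing_weight q x.
Proof. exact: big_cat. Qed.

Lemma packing_value_cat eta p q :
  packing_value eta (p ++ q) = packing_value eta p + packing_value eta q.
Proof. exact: big_cat. Qed.

Definition packing_scale (a : R) p := [seq (a * e.1, e.2) | e <- p].

Lemma packing_weight_scale a p x :
  packing_weight (packing_scale a p) x = a * packing_weight p x.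
Proof.
by rewrite /packing_weight big_map mulr_sumr; apply: eq_bigr => e _; rewrite mulrA.
Qed.

Lemma packing_value_scale eta a p :
  packing_value eta (packing_scale a p) = a * packing_value eta p.
Proof.
by rewrite /packing_value big_map mulr_sumr; apply: eq_bigr => e _; rewrite mulrA.
Qed.

Definition packing_bounded (S : R) eta : Prop :=
  forall p, packing p 1 -> packing_value eta p <= S.

(** The bound is homogeneous in the multiplicity u. The case u = 0 follows
    by letting positive multiplicities decrease to 0. *)
Lemma packing_bounded_scale S eta p u : packing_bounded S eta ->
  0 <= u -> packing p u -> packing_value eta p <= S * u.
Proof.
move=> etaS u0 [pm pw].
have pos v : 0 < v -> (forall x, packing_weight p x <= v) -> packing_value eta p <= S * v.
  move=> v0 pv; rewrite -ler_pdivrMr // mulrC -packing_value_scale; apply: etaS.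
  split=> [_ /mapP[e ep ->]/=|x].
    by have [? ?] := pm _ ep; rewrite mulr_ge0 // invr_ge0 ltW.
  by rewrite packing_weight_scale mulrC ler_pdivrMr // mul1r.
have S0 : 0 <= S.
  have := etaS [::]; rewrite /packing_value big_nil; apply; split=> // x.
  by rewrite /packing_weight big_nil.
apply/ler_addgt0Pr => e e0.
have S1 : 0 < S + 1 by rewrite ltr_pwDr.
have es : 0 < e / (S + 1) by rewrite divr_gt0.
apply: le_trans (pos (u + e / (S + 1)) _ _) _.
- by rewrite ltr_wpDl.
- by move=> x; apply: le_trans (pw x) _; rewrite lerDl ltW.
rewrite mulrDr lerD2l mulrCA ger_pMr // ler_pdivrMr // mul1r; lra.
Qed.

(** If adding del at the single set A destroys the packing bound, then some
    violating packing uses A with a positive total weight a; the remaining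
    members form p. *)
Lemma packing_raise S l A del : measurable A -> 0 < del -> packing_bounded S l ->
  ~ packing_bounded S (fun B => l B + del * `[< B = A >]%:R) ->
  exists a p, [/\ 0 < a, (forall e, e \in p -> 0 <= e.1 /\ measurable e.2),
    (forall x, a * \1_A x + packing_weight p x <= 1) &
    S < a * (l A + del) + packing_value l p].
Proof.
move=> mA del0 lS /existsNP[p /not_implyP[[pm pw] /negP]]; rewrite -ltNge => Sp.
pose b (e : R * set X) := `[< e.2 = A >].
pose a := \sum_(e <- p | b e) e.1.
pose q := [seq e <- p | ~~ b e].
have qE (F : R * set X -> R) : \sum_(e <- q) F e = \sum_(e <- p | ~~ b e) F e.
  by rewrite big_filter.
have a_ge0 : 0 <= a.
  by rewrite /a big_seq_cond sumr_ge0 // => e /andP[/pm[]].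
have pwE x : packing_weight p x = a * \1_A x + packing_weight q x.
  rewrite /packing_weight qE (bigID b) /=; congr (_ + _).
  by rewrite /a mulr_suml; apply: eq_bigr => e /asboolP ->.
have vE : packing_value (fun B => l B + del * `[< B = A >]%:R) p =
    a * (l A + del) + packing_value l q.
  rewrite /packing_value qE (bigID b) /=; congr (_ + _).
    rewrite /a mulr_suml; apply: eq_bigr => e be; move: (be) => /asboolP eA.
    by rewrite eA asboolT // mulr1.
  by apply: eq_bigr => e; rewrite /b => be; rewrite (negbTE be) mulr0 addr0.
exists a, q; split.
- rewrite lt_neqAle a_ge0 andbT; apply/eqP => a0.
  move: Sp; rewrite vE -a0 mul0r add0r ltNge lS //; split=> [e|x].
    by rewrite mem_filter => /andP[_ /pm].
  by have := pw x; rewrite pwE -a0 mul0r add0r.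
- by move=> e; rewrite mem_filter => /andP[_ /pm].
- by move=> x; rewrite -pwE.
- by rewrite -vE.
Qed.

Lemma packing_bounded_single S l A : packing_bounded S l -> measurable A -> l A <= S.
Proof.
move=> lS mA; have := lS [:: (1, A)]; rewrite /packing_value big_seq1 /= mul1r; apply.
split=> [e|x]; first by rewrite inE => /eqP ->.
by rewrite /packing_weight big_seq1 mul1r indicE; case: (_ \in _).
Qed.

(** Zorn's lemma applies because a packing sees only finitely many values of
    a set function, so the pointwise supremum of a chain inherits the
    packing bound. *)
Lemma maximal_packing_bounded S eta : packing_bounded S eta ->
  exists l, [/\ packing_bounded S l, forall A, measurable A -> eta A <= l A &
    forall l', packing_bounded S l' -> (forall A, measurable A -> l A <= l' A) ->
      forall A, measurable A -> l' A <= l A].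
Proof.
move=> etaS.
pose T := {l : set X -> R | packing_bounded S l /\ forall A, measurable A -> eta A <= l A}.
pose mk f fS etaf : T := exist (fun l => packing_bounded S l /\
  forall A, measurable A -> eta A <= l A) f (conj fS etaf).
pose t0 : T := mk eta etaS (fun A _ => lexx _).
pose le (l1 l2 : T) : Prop := forall A, measurable A -> sval l1 A <= sval l2 A.
have [||C Ctot|l lmax] := @ZL_preorder T t0 (fun l1 l2 => `[< le l1 l2 >]).
- by move=> l; apply/asboolP.
- move=> l1 l2 l3 /asboolP l12 /asboolP l23; apply/asboolP => A mA.
  by apply: le_trans (l23 A mA); exact: l12.
- have [[l0 Cl0]|C0] := pselect (exists l, C l); last first.
    exists t0 => s Cs.
    by exfalso; apply: C0; exists s.
  pose V A := [set sval l A | l in C].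
  have Vsup A : measurable A -> has_sup (V A).
    move=> mA; split; first by exists (sval l0 A), l0.
    exists S => _ [l Cl <-]; apply: packing_bounded_single => //.
    by have [] := svalP l.
  have Vle A l : measurable A -> C l -> sval l A <= sup (V A).
    by move=> mA Cl; apply: sup_upper_bound; [exact: Vsup|exists l].
  have approx p del : 0 < del -> (forall e, e \in p -> measurable e.2) ->
      exists2 l, C l & forall e, e \in p -> sup (V e.2) <= sval l e.2 + del.
    move=> del0; elim: p => [_|e p IH pm]; first by exists l0.
    have me : measurable e.2 by apply: pm; rewrite mem_head.
    have [|l Cl lp] := IH; first by move=> e' e'p; apply: pm; rewrite inE e'p orbT.
    have [_ [l' Cl' <-] l'e] := sup_adherent del0 (Vsup _ me).
    have {}l'e : sup (V e.2) <= sval l' e.2 + del by rewrite -lerBlDr ltW.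
    have mp e' : e' \in p -> measurable e'.2.
      by move=> e'p; apply: pm; rewrite inE e'p orbT.
    have [/asboolP ll'|/asboolP l'l] := Ctot _ _ Cl Cl'.
      exists l' => // e'; rewrite inE => /predU1P[->//|e'p].
      by apply: le_trans (lp _ e'p) _; rewrite lerD2r; apply: ll'; exact: mp.
    exists l => // e'; rewrite inE => /predU1P[->|e'p]; last exact: lp.
    by apply: le_trans l'e _; rewrite lerD2r; exact: l'l.
  have supS : packing_bounded S (fun A => sup (V A)).
    move=> p pk; have [pm pw] := pk; apply/ler_addgt0Pr => del del0.
    pose M := \sum_(e <- p) e.1.
    have M0 : 0 <= M by rewrite /M big_seq sumr_ge0 // => e /pm[].
    have M1 : 0 < M + 1 by rewrite ltr_pwDr.
    have [|l Cl lp] := approx p (del / (M + 1)) (divr_gt0 del0 M1).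
      by move=> e /pm[].
    have [lS _] := svalP l.
    apply: (@le_trans _ _ (packing_value (sval l) p + M * (del / (M + 1)))).
      rewrite /packing_value /M mulr_suml -big_split /= big_seq [leRHS]big_seq.
      apply: ler_sum => e ep; rewrite -mulrDr ler_wpM2l ?lp //.
      by have [] := pm _ ep.
    by rewrite lerD ?lS // mulrCA ger_pMr // ler_pdivrMr // mul1r lerDl.
  have supeta A : measurable A -> eta A <= sup (V A).
    move=> mA; apply: le_trans (Vle _ _ mA Cl0); have [_ h] := svalP l0; exact: h.
  exists (mk _ supS supeta) => l Cl; apply/asboolP => A mA /=; exact: Vle.
- have [lS etal] := svalP l; exists (sval l); split=> // l' l'S ll'.
  have etal' A : measurable A -> eta A <= l' A.
    by move=> mA; apply: le_trans (ll' _ mA); exact: etal.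
  have /asboolP h := lmax (mk l' l'S etal') (introT (asboolP _) ll').
  exact: h.
Qed.

(** A maximal set function l with the packing bound S is additive. Indeed,
    for measurable A, B, C that partition the space the packing of the three
    sets gives l A + l B + l C <= S. By maximality l cannot be raised at A,
    at B or at C; combining the three violating packings, each scaled by the
    product of the weights of the other two sets, yields the converse
    inequality up to an arbitrary e. So the sum is S for every such
    partition. This replaces a separation argument in a space of functions. *)
Lemma additive_majorant S eta : (forall A, measurable A -> 0 <= eta A) ->
  packing_bounded S eta ->
  exists l, [/\ forall A, measurable A -> eta A <= l A, l set0 = 0 &
    forall A B, measurable A -> measurable B -> A `&` B = set0 ->
      l (A `|` B) = l A + l B].
Proof.
move=> eta0 /maximal_packing_bounded[l [lS etal lmax]].
have raise A del : measurable A -> 0 < del ->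
    exists a p, [/\ 0 < a, (forall e, e \in p -> 0 <= e.1 /\ measurable e.2),
    (forall x, a * \1_A x + packing_weight p x <= 1) &
    S < a * (l A + del) + packing_value l p].
  move=> mA del0; apply: packing_raise => // l'S.
  have := lmax _ l'S _ _ mA; rewrite asboolT // mulr1 leNgt ltrDl del0.
  suff h : forall B, measurable B -> l B <= l B + del * (`[< B = A >])%:R by move/(_ h).
  by move=> B mB; rewrite lerDl mulr_ge0 // ltW.
have split3 A B C : measurable A -> measurable B -> measurable C ->
    (forall x, \1_A x + \1_B x + \1_C x = 1 :> R) -> l A + l B + l C = S.
  move=> mA mB mC ABC; apply/eqP; rewrite eq_le; apply/andP; split.
    have := lS [:: (1, A); (1, B); (1, C)].
    rewrite /packing_value !big_cons big_nil /= !mul1r addr0 addrA; apply; split.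
      by move=> e; rewrite !inE => /or3P[] /eqP ->.
    by move=> x; rewrite /packing_weight !big_cons big_nil /= !mul1r addr0 addrA ABC.
  apply/ler_addgt0Pr => e e0; have e3 : 0 < e / 3 by rewrite divr_gt0.
  have [a [pa [a0 pam paw pav]]] := raise A _ mA e3.
  have [b [pb [b0 pbm pbw pbv]]] := raise B _ mB e3.
  have [c [pc [c0 pcm pcw pcv]]] := raise C _ mC e3.
  pose q := packing_scale (b * c) pa ++ packing_scale (a * c) pb ++ packing_scale (a * b) pc.
  (* The three leftover packings together have multiplicity at most u, since
     the indicators of A, B and C add up to 1. *)
  pose u := b * c + a * c + a * b - a * b * c.
  have q_ge0 e' : e' \in q -> 0 <= e'.1 /\ measurable e'.2.
    rewrite !mem_cat => /or3P[] /mapP[e'' e''p -> /=].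
    - by have [? ?] := pam _ e''p; rewrite mulr_ge0 // mulr_ge0 // ltW.
    - by have [? ?] := pbm _ e''p; rewrite mulr_ge0 // mulr_ge0 // ltW.
    - by have [? ?] := pcm _ e''p; rewrite mulr_ge0 // mulr_ge0 // ltW.
  have qw x : packing_weight q x <= u.
    rewrite !packing_weight_cat !packing_weight_scale.
    have ha := ler_wpM2l (ltW (mulr_gt0 b0 c0)) (paw x).
    have hb := ler_wpM2l (ltW (mulr_gt0 a0 c0)) (pbw x).
    have hc := ler_wpM2l (ltW (mulr_gt0 a0 b0)) (pcw x).
    rewrite /u; have := ABC x; move: ha hb hc.
    move: (packing_weight pa x) (packing_weight pb x) (packing_weight pc x).
    move: (\1_A x) (\1_B x) (\1_C x) => iA iB iC wa wb wc ha hb hc ABCx.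
    have -> : a * b * c = a * b * c * (iA + iB + iC) by rewrite ABCx mulr1.
    lra.
  have u0 : 0 <= u.
    apply: le_trans (packing_weight_ge0 point _) (qw point) => e' /q_ge0[] //.
  have := packing_bounded_scale lS u0 (conj q_ge0 qw).
  rewrite !packing_value_cat !packing_value_scale => qv.
  have ha := ltr_pM2l (mulr_gt0 b0 c0) S (a * (l A + e / 3) + packing_value l pa).
  have hb := ltr_pM2l (mulr_gt0 a0 c0) S (b * (l B + e / 3) + packing_value l pb).
  have hc := ltr_pM2l (mulr_gt0 a0 b0) S (c * (l C + e / 3) + packing_value l pc).
  rewrite pav in ha; rewrite pbv in hb; rewrite pcv in hc.
  have abc : 0 < a * b * c by rewrite !mulr_gt0.
  rewrite -(ler_pM2l abc); move: qv ha hb hc; rewrite /u.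
  move: (packing_value l pa) (packing_value l pb) (packing_value l pc) => va vb vc qv ha hb hc.
  have -> : a * b * c * (l A + l B + l C + e) = 
    b * c * (a * (l A + e / 3)) + a * c * (b * (l B + e / 3)) + a * b * (c * (l C + e / 3)) by field.
  lra.
have l0 : l set0 = 0.
  apply/eqP; rewrite eq_le (le_trans (eta0 _ measurable0) (etal _ measurable0)) andbT.
  rewrite leNgt; apply/negP => lpos.
  have S0 : 0 <= S by apply: le_trans (ltW lpos) (packing_bounded_single lS measurable0).
  have := lS [:: ((S + 1) / l set0, set0)].
  rewrite /packing_value big_seq1 /= mulfVK ?gt_eqF // => h.
  have : S + 1 <= S.
    apply: h; split=> [e|x].
      by rewrite inE => /eqP -> /=; split=> //; rewrite divr_ge0 ?addr_ge0 // ltW.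
    by rewrite /packing_weight big_seq1 /= indic0 /= mulr0.
  by rewrite leNgt ltrDl ltr01.
exists l; split=> // A B mA mB AB.
have ind0 x : \1_(@set0 X) x = 0 :> R by rewrite indic0.
have indE x : \1_A x + \1_B x + \1_(~` (A `|` B)) x = 1 :> R.
  rewrite !indicE; have [xA|xA] := boolP (x \in A).
    have xB : x \notin B.
      by apply/negP => xB; have [] : set0 x by rewrite -AB; split; exact/set_mem.
    rewrite (negbTE xB) memNset ?addr0 //= => -[]; left; exact/set_mem.
  have [xB|xB] := boolP (x \in B).
    by rewrite memNset ?addr0 ?add0r //= => -[]; right; exact/set_mem.
  rewrite mem_set ?add0r //= => -[] /mem_set; exact/negP.
have mAB : measurable (A `|` B) by exact: measurableU.
have mC : measurable (~` (A `|` B)) by exact: measurableC.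
have := split3 _ _ _ mA mB mC indE.
rewrite -(split3 _ _ _ mAB measurable0 mC) ?l0; first by move/eqP; rewrite addr0 -addrA; lra.
move=> x; rewrite ind0 addr0 !indicE in_setC.
by case: (x \in _); rewrite /= ?addr0 ?add0r.
Qed.

End Packing.

(** * The countably additive part of an additive set function *)

Section CountableMinorant.
Context (d : measure_display) (X : measurableType d) (R : realType).

(** The absolute value makes the set function nonnegative on all sets, which
    the outer measure construction asks for; on measurable sets it changes
    nothing when l is nonnegative. *)
Definition content_of (l : set X -> R) (A : set X) : \bar R := (`|l A|)%:E.

Lemma content_of_ge0 l A : (0 <= content_of l A)%E.
Proof. by rewrite lee_fin. Qed.

(** The outer measure generated by l takes infima of sums over countable
    covers. Additivity of l splits any cover along a measurable set, which
    is therefore Caratheodory measurable, and there the outer measure is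
    countably additive. *)
Lemma countably_additive_minorant (l : set X -> R) :
  (forall A, measurable A -> 0 <= l A) -> l set0 = 0 ->
  (forall A B, measurable A -> measurable B -> A `&` B = set0 ->
      l (A `|` B) = l A + l B) ->
  exists nu : {measure set X -> \bar R}, forall E, measurable E ->
    nu E = mu_ext (content_of l) E.
Proof.
move=> l_ge0 l0 lU.
have m0 : content_of l set0 = 0%E by rewrite /content_of l0 normr0.
pose out0 := isOuterMeasure.Build R X _ (mu_ext0 m0 (content_of_ge0 l))
  (mu_ext_ge0 (content_of_ge0 l)) (le_mu_ext (content_of l))
  (mu_ext_sigma_subadditive (content_of_ge0 l)).
pose out : {outer_measure set X -> \bar R} := HB.pack (mu_ext (content_of l)) out0.
have cara E : measurable E -> out.-caratheodory E.
  move=> mE; apply: le_caratheodory_measurable => A.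
  apply: le_ereal_inf_tmp => _ [B [mB AB] <-]; have {}mB k : measurable (B k) := mB k.
  have BE k : content_of l (B k) = (content_of l (B k `&` E) + content_of l (B k `&` ~` E))%E.
    have mBE : measurable (B k `&` E) by exact: measurableI.
    have mBE' : measurable (B k `&` ~` E) by apply: measurableI => //; exact: measurableC.
    rewrite /content_of -EFinD !ger0_norm ?l_ge0 //.
    rewrite -lU // -?setIUr ?setUv ?setIT //.
    by rewrite setIACA setICr setI0.
  rewrite (eq_eseriesr (fun k _ => BE k)).
  rewrite nneseriesD; [|by move=> *; exact: content_of_ge0..].
  apply: leeD; apply: ereal_inf_lbound.
    exists (fun k => B k `&` E) => //; split=> [k|x [Ax Ex]]; first exact: measurableI.
    by have [k _ Bk] := AB x Ax; exists k.
  exists (fun k => B k `&` ~` E) => //; split=> [k|x [Ax Ex]].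
    by apply: measurableI => //; exact: measurableC.
  by have [k _ Bk] := AB x Ax; exists k.
pose nu0 := isMeasure.Build _ X R (fun A => out A) (outer_measure0 out) (outer_measure_ge0 out).
have sadd : semi_sigma_additive ((fun A => out A) : set X -> \bar R).
  move=> F mF tF mUF.
  apply: (@caratheodory_measure_sigma_additive R X out) => //.
  - by move=> k; exact: cara.
  - exact: cara.
pose nu : {measure set X -> \bar R} := HB.pack (fun A => out A) (nu0 sadd).
by exists nu.
Qed.

End CountableMinorant.

(** * Integrals of powers *)

Section PowerIntegral.
Context (R : realType).

(** The integral of a nonnegative function is a supremum over simple
    functions below it, so it is monotone even on functions that are not
    known to be measurable, such as rearrangements. *)
Lemma ge0_le_integral_nonmeasurable (d : measure_display) (X : measurableType d)
  (mu : {measure set X -> \bar R}) (D : set X) (f g : X -> \bar R) :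
  (forall x, D x -> (0 <= f x)%E) -> (forall x, D x -> (f x <= g x)%E) ->
  (\int[mu]_(x in D) f x <= \int[mu]_(x in D) g x)%E.
Proof.
move=> f0 fg; rewrite !ge0_integralE //; last first.
  by move=> x Dx; apply: le_trans (fg x Dx); exact: f0.
apply: le_ereal_sup => _ [h hf <-]; exists h => // x; apply: le_trans (hf x) _.
by rewrite /patch; case: ifPn => // /set_mem; exact: fg.
Qed.

Lemma measurable_powR_kernel (D : set R) (k : R) : measurable D ->
  measurable_fun D (EFin \o (fun u : R => k * u `^ (k - 1))).
Proof.
move=> mD; apply/measurable_EFinP; apply: measurable_funM => //.
by apply: measurable_funTS; exact: measurable_powR.
Qed.

(** The integrand is unbounded at 0 when k < 1, so the fundamental theorem
    of calculus is used on the intervals from m / (i + 1) to m, which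
    exhaust the half-open interval. *)
Lemma integral_powR (k m : R) : 0 < k -> 0 <= m ->
  (\int[lebesgue_measure]_(u in `]0%R, m[) (k * u `^ (k - 1))%:E = (m `^ k)%:E)%E.
Proof.
move=> k0; rewrite le_eqVlt => /predU1P[<-|m0].
  by rewrite set_itv_ge ?bnd_simp ?ltxx // integral_set0 powR0 // gt_eqF.
have ge0 u : (0 <= (k * u `^ (k - 1))%:E)%E.
  by rewrite lee_fin mulr_ge0 ?powR_ge0 // ltW.
pose a (i : nat) := m / i.+1%:R.
have a0 i : 0 < a i by rewrite divr_gt0.
have am i : a i <= m by rewrite ler_pdivrMr // ler_peMr ?ler1n // ltW.
pose F i : set R := `[a i, m]%classic.
have UF : \bigcup_i F i = `]0, m]%classic.
  apply/seteqP; split=> [x [i _]|x]; rewrite /F /= !in_itv /=.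
    by move=> /andP[ax ->]; rewrite (lt_le_trans (a0 i)).
  move=> /andP[x0 xm]; exists (Num.truncn (m / x)) => //=; rewrite in_itv /= xm andbT.
  rewrite /a ler_pdivrMr // mulrC -ler_pdivrMr // ltW //.
  by rewrite Num.Theory.truncnS_gt.
have cvgF : ((\int[lebesgue_measure]_(u in F i) (k * u `^ (k - 1))%:E)%E @[i --> \oo] -->
   (\int[lebesgue_measure]_(u in `]0%R, m]) (k * u `^ (k - 1))%:E)%E).
  rewrite -UF; apply: ge0_nondecreasing_set_cvg_integral => //.
  - move=> i j ij; rewrite subsetEset; apply: subset_itvr.
    rewrite bnd_simp /a ler_wpM2l ?(ltW m0) // lef_pV2 ?posrE //.
    by rewrite ler_nat ltnS.
  - by move=> i; exact: measurable_itv.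
  - by move=> i; apply: measurable_powR_kernel; exact: measurable_itv.
rewrite -(@integral_itv_bndoo _ _ _ _ false false); last first.
  by apply: measurable_powR_kernel; exact: measurable_itv.
move/cvg_lim : cvgF => <- //; apply/cvg_lim => //.
have der x : 0 < x -> derivable ((@powR R)^~ k) x 1.
  by move=> x0; apply: derivable_powR; rewrite in_itv /= x0.
have cont x : 0 < x -> {for x, continuous ((@powR R)^~ k)}.
  by move=> x0; apply/differentiable_continuous/derivable1_diffP; exact: der.
have intF i : (\int[lebesgue_measure]_(u in F i) (k * u `^ (k - 1))%:E =
    (m `^ k - (a i) `^ k)%:E)%E.
  have := am i; rewrite le_eqVlt => /predU1P[aim|aim].
    by rewrite /F -aim set_itv1 integral_set1 subrr.
  rewrite /F (@continuous_FTC2 _ _ ((@powR R)^~ k)) //.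
  - apply: derivable_within_continuous => x; rewrite in_itv /= => /andP[ax _].
    apply: derivableM; first exact: derivable_cst.
    by apply: derivable_powR; rewrite in_itv /= andbT (lt_le_trans (a0 i)).
  - split.
    + by move=> x; rewrite in_itv /= => /andP[ax _]; apply: der; exact: lt_trans ax.
    + by apply: cvg_at_right_filter; exact: cont.
    + by apply: cvg_at_left_filter; exact: cont.
  - move=> x; rewrite in_itv /= => /andP[ax _].
    by rewrite powR_derive1 // in_itv /= andbT (lt_trans (a0 i)).
under eq_fun do rewrite intF.
apply/cvg_EFin; first by near=> i.
rewrite -[X in _ --> X]subr0; apply: cvgB; first exact: cvg_cst.
have /cvg_at_rightP := powR_cvg0 k0; apply; split=> //.
rewrite -(mulr0 m); apply: cvgM; first exact: cvg_cst.
exact: cvg_harmonic.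
Unshelve. all: by end_near. Qed.

End PowerIntegral.

(** * Lorentz quasi-norms *)

Section Lorentz.
Context (d : measure_display) (X : measurableType d) (R : realType).
Implicit Types (nu : set X -> \bar R) (h : X -> R).

Lemma rearrangement_ge0 nu h u : (0 <= rearrangement nu h u)%E.
Proof.
by apply: le_ereal_inf_tmp => _ [E _ <-]; rewrite le_max lexx.
Qed.

Lemma lorentz_norm_ge0 a r nu h : (0 <= lorentz_norm a r nu h)%E.
Proof. exact: poweR_ge0. Qed.

Lemma lorentz_norm_powR a r nu h : 0 < a -> 0 < r ->
  (lorentz_norm a r nu h `^ r = \int[lebesgue_measure]_(t in `]0%R, +oo[)
      ((r / a * t `^ (r / a - 1))%:E * rearrangement nu h t `^ r))%E.
Proof.
move=> a0 r0; rewrite /lorentz_norm -poweRrM mulVf ?gt_eqF // poweRe1 //.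
apply: integral_ge0 => t _; apply: mule_ge0; last exact: poweR_ge0.
by rewrite lee_fin mulr_ge0 ?powR_ge0 // divr_ge0 ?ltW.
Qed.

(** A weak-type bound on an initial interval and vanishing beyond it leave a
    convergent power integral. With b = 0 this covers bounded functions,
    with b = s^-1 functions in L_s, in both cases with support of measure at
    most m. *)
Lemma lorentz_norm_le a r b D m nu h : 0 < a -> 0 < r -> b < a^-1 ->
  0 <= D -> 0 <= m ->
  (forall u, 0 < u -> u < m -> (rearrangement nu h u <= (D * u `^ (- b))%:E)%E) ->
  (forall u, 0 < u -> m <= u -> (rearrangement nu h u <= 0)%E) ->
  (lorentz_norm a r nu h <=
    (((a^-1 / (a^-1 - b)) `^ r^-1) * D * m `^ (a^-1 - b))%:E)%E.
Proof.
move=> a0 r0 ba D0 m0 hlt hge.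
have ab0 : 0 < a^-1 - b by rewrite subr_gt0.
pose k := r * (a^-1 - b); have k0 : 0 < k by rewrite mulr_gt0.
pose c := a^-1 / (a^-1 - b); have c0 : 0 <= c by rewrite divr_ge0 ?invr_ge0 ?ltW.
have ra0 : 0 <= r / a by rewrite divr_ge0 ?ltW.
suff h1 : (lorentz_norm a r nu h `^ r <= (c * D `^ r * m `^ k)%:E)%E.
  have rV0 : 0 <= r^-1 by rewrite invr_ge0 ltW.
  have I1 : (lorentz_norm a r nu h `^ r)%E \in `[0%E, +oo%E].
    by rewrite in_itv /= poweR_ge0 leey.
  have I2 : (c * D `^ r * m `^ k)%:E \in `[0%E, +oo%E].
    by rewrite in_itv /= leey andbT lee_fin mulr_ge0 ?powR_ge0 // mulr_ge0 ?powR_ge0.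
  have := gt0_ler_poweR rV0 I1 I2 h1.
  rewrite -poweRrM divff ?gt_eqF // poweRe1 ?lorentz_norm_ge0 //.
  move=> /le_trans; apply.
  - rewrite poweR_EFin lee_fin (powRM _ (mulr_ge0 c0 (powR_ge0 D r)) (powR_ge0 m k)).
    rewrite (powRM _ c0 (powR_ge0 D r)) -(powRrM D) -(powRrM m).
    have -> : k * r^-1 = a^-1 - b by rewrite /k mulrAC divff ?gt_eqF // mul1r.
    by rewrite divff ?gt_eqF // powRr1.
rewrite lorentz_norm_powR //.
pose g : R -> \bar R := (fun u => (c * D `^ r)%:E * (k * u `^ (k - 1))%:E)%E \_ `]0, m[.
have g_ge0 u : (0 <= (k * u `^ (k - 1))%:E)%E.
  by rewrite lee_fin mulr_ge0 ?powR_ge0 // ltW.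
apply: (@le_trans _ _ (\int[lebesgue_measure]_(u in `]0%R, +oo[) g u)%E).
  apply: ge0_le_integral_nonmeasurable => u; rewrite /= in_itv /= andbT => u0.
    by apply: mule_ge0; [rewrite lee_fin mulr_ge0 ?powR_ge0|exact: poweR_ge0].
  have [um|mu] := ltP u m; last first.
    have /eqP -> : rearrangement nu h u == 0%E.
      by rewrite eq_le hge // rearrangement_ge0.
    rewrite poweR0r ?gt_eqF // mule0 /g /patch; case: ifP => // _.
    by rewrite mule_ge0 // lee_fin mulr_ge0 ?powR_ge0.
  rewrite /g /patch mem_set /= ?in_itv /= ?u0 //.
  apply: (@le_trans _ _ ((r / a * u `^ (r / a - 1))%:E * (D * u `^ (- b))%:E `^ r)%E).
    apply: lee_wpmul2l; first by rewrite lee_fin mulr_ge0 ?powR_ge0.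
    apply: gt0_ler_poweR; rewrite ?in_itv /= ?leey ?andbT ?rearrangement_ge0 ?(ltW r0) //.
      by rewrite lee_fin mulr_ge0 ?powR_ge0.
    exact: hlt.
  rewrite poweR_EFin -!EFinM lee_fin powRM ?powR_ge0 // -powRrM.
  have -> : k - 1 = r / a - 1 + - b * r by rewrite /k; ring.
  rewrite (@powRD _ u (r / a - 1) (- b * r)); last by rewrite (gt_eqF u0) implybT.
  rewrite le_eqVlt; apply/orP; left; apply/eqP.
  transitivity ((c * k) * u `^ (r / a - 1) * (D `^ r * u `^ (- b * r))); last by ring.
  by congr (_ * _ * _); rewrite /c /k mulrCA divfK ?gt_eqF.
rewrite /g -integral_mkcondr.
have -> : (`]0, +oo[ `&` `]0, m[)%classic = `]0, m[%classic :> set R.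
  by apply/setIidPr => u /=; rewrite !in_itv /= => /andP[->].
rewrite ge0_integralZl //.
- by rewrite integral_powR // -EFinM lexx.
- by apply: measurable_powR_kernel; exact: measurable_itv.
- by rewrite lee_fin mulr_ge0 ?powR_ge0.
Qed.

Lemma powR2_gt1 (r : R) : 0 < r -> 1 < 2 `^ r.
Proof.
move=> r0; rewrite -[X in X < _](_ : 1 `^ r = 1); last by rewrite powR1.
by apply: gt0_ltr_powR; rewrite ?nnegrE ?ltr1n.
Qed.

(** A geometric sum is dominated by its last admissible term. *)
Lemma dyadic_sum_le (r y z : R) (P : pred nat) N : 0 < r -> 0 < y -> 0 <= z ->
  (forall n, (n < N)%N -> P n -> y * 2 ^+ n <= z) ->
  \sum_(n < N | P n) (y * 2 ^+ n) `^ r <= 2 `^ r / (2 `^ r - 1) * z `^ r.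
Proof.
move=> r0 y0 z0.
have b1 := powR2_gt1 r0.
have K0 : 0 <= 2 `^ r / (2 `^ r - 1) :> R by rewrite divr_ge0 ?powR_ge0 // subr_ge0 ltW.
have full n : \sum_(i < n.+1) (y * 2 ^+ i) `^ r <= 2 `^ r / (2 `^ r - 1) * (y * 2 ^+ n) `^ r.
  have E i : (y * 2 ^+ i) `^ r = y `^ r * (2 `^ r) ^+ i.
    by rewrite powRM ?exprn_ge0 ?ltW // -!powR_mulrn ?powR_ge0 ?ler0n // powRAC.
  under eq_bigr do rewrite E.
  rewrite E -mulr_sumr mulrCA ler_wpM2l ?powR_ge0 //.
  elim: n => [|n IH].
    rewrite big_ord1 !expr0 mulr1 ler_pdivlMr ?subr_gt0 // mul1r; lra.
  rewrite big_ord_recr /= -lerBrDr; apply: le_trans IH _.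
  rewrite exprS le_eqVlt; apply/orP; left; apply/eqP; field.
  by rewrite subr_eq0 gt_eqF.
elim: N => [|N IH] hP; first by rewrite big_ord0 mulr_ge0 ?powR_ge0.
have [PN|PN] := boolP (P N).
  apply: (@le_trans _ _ (\sum_(i < N.+1) (y * 2 ^+ i) `^ r)).
    by rewrite big_mkcond ler_sum // => i _; case: ifP; rewrite ?powR_ge0.
  apply: le_trans (full N) _; rewrite ler_wpM2l //.
  by apply: ge0_ler_powR; rewrite ?nnegrE ?mulr_ge0 ?exprn_ge0 ?(ltW y0) ?(ltW r0) //; exact: hP.
rewrite big_mkcond big_ord_recr /= (negbTE PN) addr0 -big_mkcond /=.
by apply: IH => n nN; apply: hP; exact: ltnW.
Qed.

(** If u is below the measure of the set where |h| > y * 2 ^+ n, then no set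
    of measure at most u covers it, so the rearrangement at u is at least y
    * 2 ^+ n. By the geometric sum the r-th power of the rearrangement
    dominates, up to a constant, the sum of the (y * 2 ^+ n) `^ r over all
    such n, and integrating this against the kernel gives the claim. *)
Lemma lorentz_norm_dyadic_ge a r nu h y N : 0 < a -> 0 < r -> 0 < y ->
  measurable_fun setT h ->
  (forall A, measurable A -> nu A \is a fin_num /\ (0 <= nu A)%E) ->
  (forall A B, measurable A -> measurable B -> A `<=` B -> (nu A <= nu B)%E) ->
  ((\sum_(n < N) (y * 2 ^+ n) `^ r *
     fine (nu [set x | y * 2 ^+ n < `|h x| ]%R) `^ (r / a))%:E <=
   (2 `^ r / (2 `^ r - 1))%:E * lorentz_norm a r nu h `^ r)%E.
Proof.
move=> a0 r0 y0 mh nufin numon.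
have b1 := powR2_gt1 r0.
pose K : R := 2 `^ r / (2 `^ r - 1).
have K0 : 0 < K by rewrite divr_gt0 ?powR_gt0 // subr_gt0.
have ra0 : 0 < r / a by rewrite divr_gt0.
pose L n := [set x | y * 2 ^+ n < `|h x| ].
have mL n : measurable (L n).
  have -> : L n = setT `&` (fun x => `|h x|) @^-1` `]y * 2 ^+ n, +oo[.
    by apply/seteqP; split=> x; rewrite /L /= in_itv /= andbT => // -[].
  by apply: (measurableT_comp _ mh) => //; exact: measurable_itv.
pose D n := fine (nu (L n)).
have D0 n : 0 <= D n by rewrite fine_ge0 //; have [] := nufin _ (mL n).
pose ker (u : R) := (r / a * u `^ (r / a - 1))%:E.
have ker0 u : (0 <= ker u)%E by rewrite lee_fin mulr_ge0 ?powR_ge0 // ltW.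
rewrite -lee_pdivrMl // -EFinM lorentz_norm_powR //.
pose g n : R -> \bar R := (fun u => (K^-1 * (y * 2 ^+ n) `^ r)%:E * ker u)%E \_ `]0, D n[.
have c0 n : 0 <= K^-1 * (y * 2 ^+ n) `^ r by rewrite mulr_ge0 ?powR_ge0 // invr_ge0 ltW.
have gE n : (\int[lebesgue_measure]_(u in `]0%R, +oo[) g n u =
    (K^-1 * ((y * 2 ^+ n) `^ r * D n `^ (r / a)))%:E)%E.
  rewrite /g -integral_mkcondr.
  have -> : (`]0, +oo[ `&` `]0, D n[)%classic = `]0, D n[%classic :> set R.
    by apply/setIidPr => u /=; rewrite !in_itv /= => /andP[->].
  rewrite ge0_integralZl //; first by rewrite integral_powR // -EFinM mulrA.
  - by apply: measurable_powR_kernel; exact: measurable_itv.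
  - by rewrite lee_fin.
have g0 n u : (0 <= g n u)%E.
  by rewrite /g /patch; case: ifP => // _; rewrite mule_ge0 // lee_fin.
rewrite mulr_sumr -sumEFin.
rewrite (eq_bigr (fun n : 'I_N => (\int[lebesgue_measure]_(u in `]0%R, +oo[) g n u)%E)); last first.
  by move=> n _; rewrite gE.
rewrite -ge0_integral_sum //; last first.
  move=> n; apply/(measurable_restrict _ (measurable_itv _) (measurable_itv _)).
  rewrite (_ : (fun _ => _) = EFin \o (fun u : R => (K^-1 * (y * 2 ^+ n) `^ r) * (r / a * u `^ (r / a - 1)))) //.
  apply/measurable_EFinP; apply: measurable_funM => //; apply: measurable_funM => //.
  by apply: measurable_funTS; exact: measurable_powR.
apply: ge0_le_integral_nonmeasurable => u; rewrite /= in_itv /= andbT => u0.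
  by apply: sume_ge0 => n _; exact: g0.
have [->|] := eqVneq (rearrangement nu h u) +oo%E.
  rewrite poweRyr ?gt_eqF // gt0_muley ?leey // lte_fin mulr_gt0 ?powR_gt0 //.
have := rearrangement_ge0 nu h u; case zE : (rearrangement nu h u) => [z| |] // z0 _.
rewrite (eq_bigr (fun n : 'I_N => if u < D n then ((K^-1 * (y * 2 ^+ n) `^ r)%:E * ker u)%E else 0%E)); last first.
  move=> n _; rewrite /g /patch; case: ifPn => [/set_mem /=|].
    by rewrite in_itv /= => /andP[_ ->].
  by case: ifPn => // uD /negP[]; apply/mem_set; rewrite /= in_itv /= u0.
rewrite poweR_EFin.
rewrite (eq_bigr (fun n : 'I_N => (if u < D n then K^-1 * (y * 2 ^+ n) `^ r * (r / a * u `^ (r / a - 1)) else 0)%:E)); last first.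
  by move=> n _; case: ifP.
rewrite sumEFin -EFinM lee_fin -big_mkcond /= -mulr_suml mulrC.
rewrite ler_wpM2l //; first by have := ker0 u; rewrite lee_fin.
rewrite -mulr_sumr ler_pdivrMl //.
apply: (@dyadic_sum_le r y z (fun n => u < D n) N) => // n _ uD.
rewrite -lee_fin -zE; apply: le_ereal_inf_tmp => _ [E [mE Eu] <-].
have [LE|] := pselect (L n `<=` E).
  have := numon _ _ (mL n) mE LE; have [fin _] := nufin _ (mL n).
  rewrite -(fineK fin) => /le_trans /(_ Eu); rewrite lee_fin leNgt.
  by rewrite -/(D n) uD.
move=> /existsNP[x /not_implyP[Lx Ex]].
rewrite le_max; apply/orP; right; apply: (@le_trans _ _ (`|h x|)%:E).
  by rewrite lee_fin; exact: ltW.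
by apply: ereal_sup_ubound; exists x.
Qed.

End Lorentz.

(** * The space of s-integrable functions *)

Section LsSpace.
Context (d : measure_display) (X : measurableType d) (R : realType).
Context (mu : {measure set X -> \bar R}) (s : R) (s0 : 0 < s).
Implicit Types (f g : X -> R) (E : set X).

Local Notation Ls := (Lfun mu s%:E).

Definition cutoff f E : X -> R := fun x => f x * \1_E x.

(** The real value of the L_s quasi-norm, meaningful for members of L_s; for
    s < 1 it is only a quasi-norm, and all comparisons below go through the
    integral of |f| `^ s. *)
Definition Lsnorm f : R := fine ('N[mu]_s%:E [EFin \o f])%E.

Definition Lsint f : \bar R := (\int[mu]_x (`|f x| `^ s)%:E)%E.

Lemma LnormE f : ('N[mu]_s%:E [EFin \o f] = Lsint f `^ s^-1)%E.
Proof. by rewrite unlock. Qed.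

Lemma Lsint_ge0 f : (0 <= Lsint f)%E.
Proof. by apply: integral_ge0 => x _; rewrite lee_fin powR_ge0. Qed.

Lemma LfunE f : f \in Ls <-> measurable_fun setT f /\ (Lsint f < +oo)%E.
Proof.
have sV : s^-1 != 0 by rewrite invr_eq0 gt_eqF.
split=> [/andP[/set_mem mf /set_mem]|[mf fin]].
  rewrite /= /finite_norm LnormE => fin; split; first exact: mf.
  by apply: lty_poweRy fin.
apply/andP; split; apply/mem_set; first exact: mf.
by rewrite /= /finite_norm LnormE poweR_lty.
Qed.

Lemma Lfun_measurable f : f \in Ls -> measurable_fun setT f.
Proof. by case/LfunE. Qed.

Lemma Lsint_fin f : f \in Ls -> (Lsint f \is a fin_num).
Proof. by case/LfunE => _ fin; rewrite ge0_fin_numE // Lsint_ge0. Qed.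

Lemma LsnormE f : Lsnorm f = fine (Lsint f) `^ s^-1.
Proof. by rewrite /Lsnorm LnormE fine_poweR. Qed.

Lemma Lsnorm_ge0 f : 0 <= Lsnorm f.
Proof. by rewrite LsnormE powR_ge0. Qed.

Lemma Lnorm_fin f : f \in Ls -> ('N[mu]_s%:E [EFin \o f] = (Lsnorm f)%:E)%E.
Proof. by move=> /Lsint_fin fin; rewrite LnormE LsnormE -poweR_EFin fineK. Qed.

Lemma Lsnorm_powR f : Lsnorm f `^ s = fine (Lsint f).
Proof.
by rewrite LsnormE -powRrM mulVf ?gt_eqF // powRr1 // fine_ge0 // Lsint_ge0.
Qed.

Lemma measurable_powR_norm D f : measurable D -> measurable_fun setT f ->
  measurable_fun D (EFin \o (fun x => `|f x| `^ s)).
Proof.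
move=> mD mf; apply/measurable_EFinP; apply: measurable_funTS.
apply: (measurableT_comp (measurable_powR s)).
exact: measurableT_comp.
Qed.

Lemma le_Lsint f g : (forall x, `|g x| <= `|f x|) -> (Lsint g <= Lsint f)%E.
Proof.
move=> gf; apply: ge0_le_integral_nonmeasurable => x _.
  by rewrite lee_fin powR_ge0.
by rewrite lee_fin ge0_ler_powR ?nnegrE ?(ltW s0).
Qed.

(** Membership in L_s is inherited by dominated measurable functions.
    Truncations and products with bounded functions stay in L_s by this
    lemma. *)
Lemma Lfun_le f g : f \in Ls -> measurable_fun setT g ->
  (forall x, `|g x| <= `|f x|) -> g \in Ls /\ Lsnorm g <= Lsnorm f.
Proof.
move=> fL mg gf; have gi := le_Lsint gf.
have gL : g \in Ls.
  by apply/LfunE; split=> //; apply: le_lt_trans gi _; have /LfunE[] := fL.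
split=> //; rewrite !LsnormE ge0_ler_powR ?invr_ge0 ?(ltW s0) ?nnegrE ?fine_ge0 ?Lsint_ge0 //.
by rewrite fine_le // Lsint_fin.
Qed.

Lemma measurable_cutoff f E : measurable E -> measurable_fun setT f ->
  measurable_fun setT (cutoff f E).
Proof. by move=> mE mf; apply: measurable_funM => //; exact: measurable_indic. Qed.

Lemma cutoff_le f E x : `|cutoff f E x| <= `|f x|.
Proof.
rewrite /cutoff indicE; case: (_ \in _); rewrite ?mulr1 ?mulr0 ?normr0 //.
Qed.

Lemma cutoff_cutoff f E F x : cutoff (cutoff f E) F x = cutoff f (E `&` F) x.
Proof. by rewrite /cutoff indicI mulrA. Qed.

Lemma Lfun_cutoff f E : f \in Ls -> measurable E ->
  cutoff f E \in Ls /\ Lsnorm (cutoff f E) <= Lsnorm f.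
Proof.
move=> fL mE; apply: Lfun_le => //; last exact: cutoff_le.
by apply: measurable_cutoff => //; exact: Lfun_measurable.
Qed.

Lemma Lfun_mull f (a : R) : f \in Ls ->
  (fun x => a * f x) \in Ls /\ Lsnorm (fun x => a * f x) = `|a| * Lsnorm f.
Proof.
move=> fL; have mf := Lfun_measurable fL.
have E : Lsint (fun x => a * f x) = ((`|a| `^ s)%:E * Lsint f)%E.
  rewrite /Lsint -ge0_integralZl //.
  - by apply: eq_integral => x _; rewrite normrM powRM // EFinM.
  - exact: measurable_powR_norm.
split.
  apply/LfunE; split; first exact: measurable_funM.
  by rewrite E -ge0_fin_numE ?mule_ge0 ?Lsint_ge0 ?lee_fin ?powR_ge0 // fin_numM // Lsint_fin.
rewrite !LsnormE E fineM // ?Lsint_fin //= powRM ?powR_ge0 ?fine_ge0 ?Lsint_ge0 //.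
by rewrite -powRrM divff ?gt_eqF // powRr1.
Qed.

Lemma Lsint_cutoff f E : measurable E ->
  Lsint (cutoff f E) = (\int[mu]_(x in E) (`|f x| `^ s)%:E)%E.
Proof.
move=> mE; rewrite [RHS]integral_mkcond; apply: eq_integral => x _.
rewrite /cutoff /patch indicE; case: (_ \in _); rewrite ?mulr1 // mulr0 normr0.
by rewrite powR0 // gt_eqF.
Qed.

Lemma Lsnorm_cutoff_sum f n (A : 'I_n -> set X) : f \in Ls ->
  (forall i, measurable (A i)) -> (forall i j, i != j -> A i `&` A j = set0) ->
  \sum_i Lsnorm (cutoff f (A i)) `^ s <= Lsnorm f `^ s.
Proof.
move=> fL mA dA; have mf := Lfun_measurable fL.
under eq_bigr do rewrite Lsnorm_powR.
rewrite Lsnorm_powR -lee_fin -sumEFin fineK ?Lsint_fin //.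
rewrite (eq_bigr (fun i => (\int[mu]_(x in A i) (`|f x| `^ s)%:E)%E)); last first.
  move=> i _; rewrite fineK; last by apply: Lsint_fin; have [] := Lfun_cutoff fL (mA i).
  exact: Lsint_cutoff.
rewrite -ge0_integral_bigsetU //=.
- apply: ge0_subset_integral => //.
  + by apply: bigsetU_measurable => i _.
  + exact: measurable_powR_norm.
- exact: index_enum_uniq.
- apply/trivIsetP => i j _ _ ij; exact: dA.
- by apply: measurable_powR_norm => //; apply: bigsetU_measurable => i _.
Qed.

(** Dominated convergence: the quasi-norm of L_s is order continuous because
    s is finite. *)
Lemma Lsnorm_cutoff_small f (E : nat -> set X) (e : R) : f \in Ls -> 0 < e ->
  (forall n, measurable (E n)) -> (forall x, \forall n \near \oo, ~ E n x) ->
  exists n, Lsnorm (cutoff f (E n)) < e.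
Proof.
move=> fL e0 mE E0; have mf := Lfun_measurable fL.
have : ((\int[mu]_x (`|cutoff f (E n) x| `^ s)%:E)%E @[n --> \oo] -->
        (\int[mu]_(x in setT) cst 0%E x)%E).
  apply: (@dominated_cvg _ _ _ mu setT measurableT _ _ (fun x => (`|f x| `^ s)%:E)).
  - move=> n; apply: (measurable_powR_norm measurableT).
    exact: measurable_cutoff.
  - move=> x _; apply: cvg_near_cst; near=> n.
    have nE : ~ E n x by near: n; exact: E0.
    by rewrite /cutoff indicE memNset // mulr0 normr0 powR0 // gt_eqF.
  - by [].
  - apply/integrableP; split; first exact: measurable_powR_norm.
    rewrite (_ : (fun _ => _) = fun x => (`|f x| `^ s)%:E).
      by have /LfunE[] := fL.
    by apply/funext => x; rewrite /= ger0_norm // powR_ge0.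
  - move=> n x _; rewrite /= lee_fin ger0_norm ?powR_ge0 //.
    by rewrite ge0_ler_powR ?nnegrE ?(ltW s0) // cutoff_le.
rewrite integral0 => /fine_cvgP[_ /cvgrPdist_lt /(_ (e `^ s))].
rewrite powR_gt0 // => /(_ isT)[n _ /(_ n (leqnn n))] /=.
rewrite sub0r normrN ger0_norm ?fine_ge0 ?Lsint_ge0 // => h.
exists n; rewrite LsnormE.
have sV : 0 < s^-1 by rewrite invr_gt0.
have := gt0_ltr_powR sV _ _ h.
rewrite -powRrM divff ?gt_eqF // powRr1 ?(ltW e0) //; apply.
  by rewrite nnegrE fine_ge0 // Lsint_ge0.
by rewrite nnegrE powR_ge0.
Unshelve. all: by end_near. Qed.

End LsSpace.

(** * Bounded operators and dyadic decompositions *)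

Section Operator.
Context (d : measure_display) (X : measurableType d) (R : realType).
Context (mu : {measure set X -> \bar R}) (s r : R) (s0 : 0 < s) (r0 : 0 < r).
Context (Y : lmodType R) (N : Y -> R) (rBanachY : is_r_Banach r N).
Context (T : (X -> R) -> Y) (T_bl : is_bounded_linear mu s N T).
Implicit Types (f g h : X -> R) (E A B : set X).

Local Notation Ls := (Lfun mu s%:E).

Lemma qnorm0 : N 0 = 0.
Proof.
have [[_ _ NZ _] _ _] := rBanachY.
by rewrite -(scale0r 0) NZ normr0 mul0r.
Qed.

Lemma qnorm_nonneg y : 0 <= N y.
Proof. by have [[]] := rBanachY. Qed.

Lemma qnorm_powD y z : N (y + z) `^ r <= N y `^ r + N z `^ r.
Proof. by have [_ + _] := rBanachY; apply. Qed.

Lemma op_bounded : exists2 M : R, 0 <= M &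
  forall f, f \in Ls -> N (T f) <= M * Lsnorm mu s f.
Proof.
have [_ _ [M hM]] := T_bl; exists (Num.max M 0); first by rewrite le_max lexx orbT.
move=> f fL; have := hM f fL; rewrite (Lnorm_fin s0 fL) -EFinM lee_fin => /le_trans; apply.
by rewrite ler_wpM2r ?Lsnorm_ge0 // le_max lexx.
Qed.

Lemma op_ext f g : f =1 g -> T f = T g.
Proof. by move=> /funext ->. Qed.

Lemma op_cutoffU f A B : f \in Ls -> measurable A -> measurable B ->
  A `&` B = set0 -> T (cutoff f (A `|` B)) = T (cutoff f A) + T (cutoff f B).
Proof.
move=> fL mA mB AB; have [_ lin _] := T_bl.
have [fA _] := Lfun_cutoff s0 fL mA; have [fB _] := Lfun_cutoff s0 fL mB.
rewrite -[T (cutoff f A)]scale1r -lin //; congr T; apply/funext => x.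
rewrite mul1r /cutoff -mulrDr; congr (_ * _).
rewrite !indicE in_setU; have [xA|] := boolP (x \in A); have [xB|] := boolP (x \in B) => //=;
  rewrite ?addr0 ?add0r //.
have [] : set0 x by rewrite -AB; split; exact/set_mem.
Qed.

Lemma op_cutoff_powD f A B : f \in Ls -> measurable A -> measurable B ->
  A `&` B = set0 ->
  N (T (cutoff f (A `|` B))) `^ r <= N (T (cutoff f A)) `^ r + N (T (cutoff f B)) `^ r.
Proof. by move=> fL mA mB AB; rewrite op_cutoffU //; exact: qnorm_powD. Qed.

Lemma cutoff0 f x : cutoff f set0 x = 0.
Proof. by rewrite /cutoff indic0 mulr0. Qed.

Lemma cutoffT f x : cutoff f setT x = f x.
Proof. by rewrite /cutoff indicT mulr1. Qed.

Lemma op_cutoff0 f : f \in Ls -> T (cutoff f set0) = 0.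
Proof.
move=> fL; have := op_cutoffU fL measurable0 measurable0 (setI0 _).
by rewrite setU0 => /eqP; rewrite -subr_eq0 opprD addrA subrr sub0r oppr_eq0 => /eqP.
Qed.

Lemma op_zero : T (fun=> 0) = 0.
Proof.
have zL : (fun=> 0 : R) \in Ls.
  apply/(LfunE _ s0); split; first exact: measurable_cst.
  rewrite /Lsint (eq_integral (cst 0%E)) ?integral0 // => x _.
  by rewrite normr0 powR0 // gt_eqF.
by rewrite -(op_cutoff0 zL); apply: op_ext => x; rewrite cutoff0.
Qed.

Lemma op_scale a f : f \in Ls -> T (fun x => a * f x) = a *: T f.
Proof.
move=> fL; have [_ lin _] := T_bl.
have zL : (cutoff f set0) \in Ls by have [] := Lfun_cutoff s0 fL measurable0.
rewrite -[RHS]addr0 -(op_cutoff0 fL) -lin //; apply: op_ext => x.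
by rewrite cutoff0 addr0.
Qed.

(** Order continuity of L_s, transported through the bounded operator. *)
Lemma op_small f (e : R) : f \in Ls -> 0 < e ->
  forall E : nat -> set X, (forall n, measurable (E n)) ->
  (forall x, \forall n \near \oo, ~ E n x) ->
  exists n, N (T (cutoff f (E n))) `^ r < e.
Proof.
move=> fL e0 E mE E0; have [M M0 hM] := op_bounded.
pose e' := e `^ r^-1 / (M + 1).
have M1 : 0 < M + 1 by rewrite ltr_pwDr.
have e'0 : 0 < e' by rewrite divr_gt0 // powR_gt0.
have [n hn] := Lsnorm_cutoff_small s0 fL e'0 mE E0.
exists n; have [fE _] := Lfun_cutoff s0 fL (mE n).
have : N (T (cutoff f (E n))) < e `^ r^-1.
  apply: le_lt_trans (hM _ fE) _.
  apply: (@le_lt_trans _ _ ((M + 1) * Lsnorm mu s (cutoff f (E n)))).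
    by rewrite ler_wpM2r ?Lsnorm_ge0 // lerDl.
  by rewrite -ltr_pdivlMl // mulrC.
move=> /(gt0_ltr_powR r0); rewrite -powRrM mulVf ?gt_eqF // powRr1 ?(ltW e0) //.
by apply; rewrite nnegrE ?qnorm_nonneg ?powR_ge0.
Qed.

Definition level h (y z : R) : set X := [set x | y < `|h x| <= z].

Lemma measurable_level h y z : measurable_fun setT h -> measurable (level h y z).
Proof.
move=> mh; have -> : level h y z = setT `&` (fun x => `|h x|) @^-1` `]y, z].
  by apply/seteqP; split=> x; rewrite /level /= in_itv /= => // -[].
by apply: (measurableT_comp _ mh) => //; exact: measurable_itv.
Qed.

Lemma op_level_sum f h y n : f \in Ls -> measurable_fun setT h -> 0 < y ->
  N (T (cutoff f (level h y (y * 2 ^+ n)))) `^ r <=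
  \sum_(i < n) N (T (cutoff f (level h (y * 2 ^+ i) (2 * (y * 2 ^+ i))))) `^ r.
Proof.
move=> fL mh y0; elim: n => [|n IH].
  rewrite big_ord0 expr0 mulr1 (_ : level h y y = set0).
    by rewrite op_cutoff0 // qnorm0 powR0 // gt_eqF.
  by apply/seteqP; split=> x //=; rewrite /level /= => /andP[/lt_le_trans h1 /h1]; rewrite ltxx.
rewrite big_ord_recr /=; apply: le_trans (lerD IH (lexx _)).
have -> : level h y (y * 2 ^+ n.+1) = level h y (y * 2 ^+ n) `|`
    level h (y * 2 ^+ n) (2 * (y * 2 ^+ n)).
  have yn : y <= y * 2 ^+ n by rewrite ler_peMr ?(ltW y0) // exprn_ege1 // ler1n.
  have yn' : y * 2 ^+ n <= y * 2 ^+ n.+1.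
    by rewrite ler_wpM2l ?(ltW y0) // ler_weXn2l ?ler1n.
  have -> : 2 * (y * 2 ^+ n) = y * 2 ^+ n.+1 by rewrite exprS mulrCA.
  apply/seteqP; split=> x; rewrite /level /=.
    move=> /andP[a b]; case: (leP `|h x| (y * 2 ^+ n)) => c; [left|right].
      by rewrite a.
    by [].
  move=> [/andP[-> /= a]|/andP[a ->]]; first exact: le_trans yn'.
  by rewrite andbT (le_lt_trans yn a).
apply: op_cutoff_powD => //; try exact: measurable_level.
apply/seteqP; split=> x //=; rewrite /level /= => -[/andP[_ a] /andP[b _]].
by have := lt_le_trans b a; rewrite ltxx.
Qed.

Definition finite_monotone (nu : set X -> \bar R) : Prop :=
  (forall A, measurable A -> nu A \is a fin_num /\ (0 <= nu A)%E) /\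
  (forall A B, measurable A -> measurable B -> A `<=` B -> (nu A <= nu B)%E).

(** The decomposition step. The function f is cut along the dyadic level
    sets of h with values between 2 ^- m and 2 ^+ m. Subadditivity of the
    r-th power of N bounds the total by the sum of the r-th powers over the
    levels, which is a dyadic sum for the Lorentz quasi-norm of h; the part
    of f outside these levels is invisible where h = 0 and small in L_s
    elsewhere. *)
Lemma op_lorentz_le (a D : R) (nu : set X -> \bar R) f h :
  0 < a -> 0 <= D -> finite_monotone nu -> f \in Ls -> measurable_fun setT h ->
  T (cutoff f [set x | h x = 0]) = 0 ->
  (forall y, 0 < y -> N (T (cutoff f (level h y (2 * y)))) <=
     D * y * fine (nu [set x | y < `|h x|]) `^ a^-1) ->
  ((N (T f))%:E <= ((2 `^ r / (2 `^ r - 1)) `^ r^-1)%:E * D%:E * lorentz_norm a r nu h)%E.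
Proof.
move=> a0 D0 [nufin numon] fL mh Th0 Tlev.
pose K : R := 2 `^ r / (2 `^ r - 1).
have b1 := powR2_gt1 r0.
have K0 : 0 < K by rewrite divr_gt0 ?powR_gt0 // subr_gt0.
pose y m : R := (2 ^+ m)^-1.
have y0 m : 0 < y m by rewrite invr_gt0 exprn_gt0.
pose tail m := ~` (level h (y m) (y m * 2 ^+ (m + m)) `|` [set x | h x = 0]).
have mZ : measurable [set x | h x = 0].
  have -> : [set x | h x = 0] = setT `&` h @^-1` [set 0].
    by apply/seteqP; split=> x //= -[].
  by apply: mh => //; exact: measurable_set1.
have mlev z z' : measurable (level h z z') by exact: measurable_level.
have mtail m : measurable (tail m) by apply/measurableC/measurableU.
have tail0 x : \forall m \near \oo, ~ tail m x.
  have [hx0|hx0] := eqVneq (h x) 0; first by near=> m; apply; right.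
  have hx : 0 < `|h x| by rewrite normr_gt0.
  near=> m; apply; left; rewrite /level /=.
  have m2 : m%:R < 2 ^+ m :> R by rewrite -natrX ltr_nat ltn_expl.
  apply/andP; split.
    rewrite /y invf_plt ?posrE ?exprn_gt0 //; apply: lt_trans m2.
    by near: m; exact: nbhs_infty_gtr.
  rewrite /y exprD mulrA mulVf ?gt_eqF ?exprn_gt0 // mul1r ltW //; apply: lt_trans m2.
  by near: m; exact: nbhs_infty_gtr.
have split3 m : N (T f) `^ r <= N (T (cutoff f (level h (y m) (y m * 2 ^+ (m + m))))) `^ r
    + N (T (cutoff f (tail m))) `^ r.
  rewrite -(op_ext (cutoffT f)) -[setT](setUv (level h (y m) (y m * 2 ^+ (m + m)) `|` [set x | h x = 0])).
  apply: le_trans (op_cutoff_powD fL _ _ _) _; [exact: measurableU|exact: mtail|exact: setICr|].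
  rewrite lerD2r op_cutoffU //; first by rewrite Th0 addr0.
  apply/seteqP; split=> x //=; rewrite /level /= => -[/andP[hy _] hx0].
  by move: hy; rewrite hx0 normr0 ltNge (ltW (y0 _)).
pose Sm m : R := \sum_(n < m + m) (y m * 2 ^+ n) `^ r *
     fine (nu [set x | y m * 2 ^+ n < `|h x| ]%R) `^ (r / a).
have SmE m : N (T (cutoff f (level h (y m) (y m * 2 ^+ (m + m))))) `^ r <= D `^ r * Sm m.
  apply: le_trans (op_level_sum _ fL mh (y0 m)) _.
  rewrite /Sm mulr_sumr; apply: ler_sum => n _.
  have yn : 0 < y m * 2 ^+ n by rewrite mulr_gt0 // exprn_gt0.
  have Dyn : 0 <= D * (y m * 2 ^+ n) by rewrite mulr_ge0 // ltW.
  have h1 : 0 <= fine (nu [set x | y m * 2 ^+ n < `|h x| ]) `^ a^-1 by exact: powR_ge0.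
  have -> : r / a = a^-1 * r by rewrite mulrC.
  rewrite [leRHS]mulrA (powRrM _ a^-1 r) -(powRM _ D0 (ltW yn)) -(powRM _ Dyn h1).
  apply: ge0_ler_powR; rewrite ?nnegrE ?(ltW r0) ?qnorm_nonneg //.
    exact: mulr_ge0.
  exact: Tlev.
have SmL m : ((Sm m)%:E <= K%:E * lorentz_norm a r nu h `^ r)%E.
  exact: lorentz_norm_dyadic_ge.
have L0 := lorentz_norm_ge0 a r nu h.
suff main : ((N (T f) `^ r)%:E <= (D `^ r)%:E * (K%:E * lorentz_norm a r nu h `^ r))%E.
  have rV0 : 0 <= r^-1 by rewrite invr_ge0 ltW.
  have P1 : (N (T f) `^ r)%:E \in `[0%E, +oo%E] by rewrite in_itv /= leey lee_fin powR_ge0.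
  have P2 : ((D `^ r)%:E * (K%:E * lorentz_norm a r nu h `^ r))%E \in `[0%E, +oo%E].
    by rewrite in_itv /= leey andbT !mule_ge0 ?lee_fin ?powR_ge0 ?poweR_ge0 ?(ltW K0).
  have := gt0_ler_poweR rV0 P1 P2 main.
  rewrite poweR_EFin -powRrM divff ?gt_eqF // powRr1 ?qnorm_nonneg // => /le_trans; apply.
  rewrite poweRM ?lee_fin ?powR_ge0 ?mule_ge0 ?poweR_ge0 ?lee_fin ?(ltW K0) //.
  rewrite poweRM ?lee_fin ?poweR_ge0 ?(ltW K0) // -poweRrM.
  rewrite !poweR_EFin -powRrM divff ?gt_eqF // powRr1 // poweRe1 //.
  by rewrite muleA [((D)%:E * _)%E]muleC.
apply/lee_addgt0Pr => e e0.
have [m hm] := op_small fL e0 mtail tail0.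
apply: (@le_trans _ _ (D `^ r * Sm m + e)%:E).
  by rewrite lee_fin; apply: le_trans (split3 m) _; rewrite lerD // ltW.
rewrite EFinD EFinM; apply: leeD => //; apply: lee_wpmul2l => //.
by rewrite lee_fin powR_ge0.
Unshelve. all: by end_near. Qed.

End Operator.

(** * Set estimates and multiplier estimates *)

Section Equivalences.
Context (d : measure_display) (X : measurableType d) (R : realType).
Context (mu : {measure set X -> \bar R}) (q s r : R) (q0 : 0 < q) (lt_qs : q < s) (r0 : 0 < r).
Context (Y : lmodType R) (N : Y -> R) (rBanachY : is_r_Banach r N).
Context (T : (X -> R) -> Y) (T_bl : is_bounded_linear mu s N T).
Implicit Types (f g h : X -> R) (E A B : set X) (nu : set X -> \bar R).

Local Notation Ls := (Lfun mu s%:E).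

Let s0 : 0 < s. Proof. exact: lt_trans lt_qs. Qed.

Let th0 : 0 < q^-1 - s^-1.
Proof. by rewrite subr_gt0 ltf_pV2 ?posrE. Qed.

(** The set estimate with real numbers instead of extended ones, for a set
    function nu that need not be a probability measure: it is applied to
    probability measures and to w mu. *)
Definition set_bound nu (C : R) : Prop :=
  forall f E, f \in Ls -> measurable E ->
    N (T (cutoff f E)) <= C * Lsnorm mu s f * fine (nu E) `^ (q^-1 - s^-1).

Lemma finite_monotone_measure (nu : {measure set X -> \bar R}) :
  (nu setT < +oo)%E -> finite_monotone nu.
Proof.
move=> fin; split=> [A mA|A B mA mB AB]; last by apply: le_measure; rewrite ?inE.
split; last exact: measure_ge0.
rewrite ge0_fin_numE ?measure_ge0 //; apply: le_lt_trans fin.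
by apply: le_measure; rewrite ?inE.
Qed.

Lemma finite_monotone_probability (P : probability X R) : finite_monotone P.
Proof.
have P1 : (P setT < +oo)%E by rewrite probability_setT ltry.
exact: (@finite_monotone_measure P P1).
Qed.

Lemma set_bound_estimate (P : probability X R) C : 0 < C -> set_bound P C ->
  set_estimate mu N T q s.
Proof.
move=> C0 hC; exists C, P; split=> // f E fL mE.
have [fin _] := (finite_monotone_probability P).1 E mE.
by rewrite (Lnorm_fin s0 fL) -(fineK fin) poweR_EFin -!EFinM lee_fin; exact: hC.
Qed.

Lemma set_estimate_bound : set_estimate mu N T q s ->
  exists (C : R) (P : probability X R), 0 < C /\ set_bound P C.
Proof.
move=> [C [P [C0 hC]]]; exists C, P; split=> // f E fL mE.
have [fin _] := (finite_monotone_probability P).1 E mE.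
have := hC f E fL mE.
by rewrite (Lnorm_fin s0 fL) -(fineK fin) poweR_EFin -!EFinM lee_fin.
Qed.

Lemma measurable_norm_gt h y : measurable_fun setT h -> measurable [set x | y < `|h x|].
Proof.
move=> mh; have -> : [set x | y < `|h x|] = setT `&` (fun x => `|h x|) @^-1` `]y, +oo[.
  by apply/seteqP; split=> x; rewrite /= in_itv /= andbT => // -[].
by apply: (measurableT_comp _ mh) => //; exact: measurable_itv.
Qed.

Lemma set_bound_cutoff nu C f E : set_bound nu C -> f \in Ls -> measurable E ->
  N (T (cutoff f E)) <= C * Lsnorm mu s (cutoff f E) * fine (nu E) `^ (q^-1 - s^-1).
Proof.
move=> hC fL mE; have [fE _] := Lfun_cutoff s0 fL mE.
have <- : T (cutoff (cutoff f E) E) = T (cutoff f E).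
  by apply: op_ext => x; rewrite cutoff_cutoff setIid.
exact: hC.
Qed.

Lemma fine_level_le nu (b : R) h y : 0 <= b -> finite_monotone nu -> measurable_fun setT h ->
  fine (nu (level h y (2 * y))) `^ b <= fine (nu [set x | y < `|h x|]) `^ b.
Proof.
move=> b0 [nufin numon] mh.
have mL := measurable_level y (2 * y) mh; have mG := measurable_norm_gt y mh.
have [f1 p1] := nufin _ mL; have [f2 p2] := nufin _ mG.
rewrite ge0_ler_powR ?nnegrE ?fine_ge0 // fine_le // numon //.
by move=> x; rewrite /level /= => /andP[].
Qed.

(** Dyadic decomposition of f * g along the level sets of g: on the level
    between y and 2 * y the function f * g is at most 2 * y * |f|. *)
Lemma set_bound_multiplier nu C t : t^-1 = q^-1 - s^-1 ->
  0 < C -> finite_monotone nu -> set_bound nu C ->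
  exists2 C', 0 < C' & forall f g, f \in Ls ->
      measurable_fun setT g -> (forall x, `|g x| <= 1) ->
      ((N (T (fun x => (f x * g x)%R)))%:E
        <= C'%:E * 'N[mu]_s%:E [EFin \o f] * lorentz_norm t r nu g)%E.
Proof.
move=> tE C0 nuP hC.
have t0 : 0 < t by rewrite -invr_gt0 tE.
pose K : R := (2 `^ r / (2 `^ r - 1)) `^ r^-1.
have K0 : 0 < K by rewrite powR_gt0 // divr_gt0 ?powR_gt0 // subr_gt0 powR2_gt1.
exists (K * (2 * C)); first by rewrite !mulr_gt0.
move=> f g fL mg g1; have mf := Lfun_measurable s0 fL.
have [FL _] : (fun x => f x * g x) \in Ls /\ Lsnorm mu s (fun x => f x * g x) <= Lsnorm mu s f.
  apply: (Lfun_le s0 fL); first exact: measurable_funM.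
  by move=> x; rewrite normrM ler_piMr.
have nf0 := Lsnorm_ge0 mu s f.
rewrite (Lnorm_fin s0 fL) -EFinM -mulrA EFinM -/K.
apply: (op_lorentz_le s0 r0 rBanachY T_bl t0 _ nuP FL mg).
- by rewrite !mulr_ge0 // ltW.
- rewrite -(op_zero s0 T_bl); apply: op_ext => x.
  rewrite /cutoff indicE; have [/set_mem /= ->|] := boolP (x \in _); by rewrite ?mulr0 ?mul0r.
move=> y y0; set E := level g y (2 * y).
have mE : measurable E by exact: measurable_level.
have [fs fsE] := Lfun_mull s0 (2 * y) fL.
have [_ le1] : cutoff (fun x => f x * g x) E \in Ls /\
    Lsnorm mu s (cutoff (fun x => f x * g x) E) <= Lsnorm mu s (fun x => 2 * y * f x).
  apply: (Lfun_le s0 fs).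
    by apply: measurable_cutoff => //; exact: measurable_funM.
  move=> x; rewrite /cutoff indicE; have [xE|] := boolP (x \in E); last first.
    by rewrite mulr0 normr0.
  rewrite mulr1 normrM (normrM (2 * y)) mulrC ler_wpM2r //.
  move/set_mem: xE => /andP[_ /le_trans]; apply; exact: ler_norm.
rewrite fsE ger0_norm in le1; last by rewrite mulr_ge0 // ltW.
apply: le_trans (set_bound_cutoff hC FL mE) _.
apply: ler_pM; rewrite ?powR_ge0 ?mulr_ge0 ?Lsnorm_ge0 ?(ltW C0) //; last first.
  by rewrite tE; apply: fine_level_le => //; exact: ltW.
apply: le_trans (ler_wpM2l (ltW C0) le1) _.
by rewrite le_eqVlt; apply/orP; left; apply/eqP; ring.
Qed.

(** Removing E itself leaves nothing of a function supported in E. *)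
Lemma rearrangement_le0 nu E u : measurable E -> (nu E <= u%:E)%E ->
  forall h, (forall x, ~ E x -> h x = 0) -> (rearrangement nu h u <= 0)%E.
Proof.
move=> mE Eu h h0; apply: ereal_inf_lbound; exists E => //.
apply/eqP; rewrite eq_le le_max lexx /= andbT ge_max lexx /=.
by apply: ge_ereal_sup => _ [x Ex <-]; rewrite h0 // normr0.
Qed.

(** The multiplier estimate is tested on indicators, whose Lorentz
    quasi-norm is the power of the measure that appears in the set estimate. *)
Lemma multiplier_set_estimate t : t^-1 = q^-1 - s^-1 ->
  multiplier_estimate mu N T r s t -> set_estimate mu N T q s.
Proof.
move=> tE [C [P [C0 hC]]].
have t0 : 0 < t by rewrite -invr_gt0 tE.
apply: (set_bound_estimate (P := P) (C := C) C0) => f E fL mE.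
have [fin P0] := (finite_monotone_probability P).1 E mE.
have L : (lorentz_norm t r P \1_E <= ((t^-1 / (t^-1 - 0)) `^ r^-1 * 1 * fine (P E) `^ (t^-1 - 0))%:E)%E.
  apply: lorentz_norm_le => //; rewrite ?invr_gt0 ?fine_ge0 //.
  - move=> u u0 _; rewrite oppr0 powRr0 mul1r.
    apply: ge_ereal_inf; exists (maxe 0 (ereal_sup [set (`|\1_E x|)%:E | x in ~` set0]))%E.
      by exists set0 => //; split=> //; rewrite measure0 lee_fin ltW.
    rewrite ge_max lee_fin ler01 /=; apply: ge_ereal_sup => _ [x _ <-].
    by rewrite lee_fin indicE ger0_norm //; case: (_ \in _).
  - move=> u u0 Eu; apply: (rearrangement_le0 mE).
      by rewrite -(fineK fin) lee_fin.
    by move=> x Ex; rewrite indicE memNset.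
move: L; rewrite subr0 divff ?invr_eq0 ?gt_eqF // powR1 !mul1r tE => L.
have mI : measurable_fun setT (\1_E : X -> R) by exact: measurable_indic.
have I1 x : `|\1_E x : R| <= 1 by rewrite indicE; case: (_ \in _); rewrite ?normr1 ?normr0.
have := hC f \1_E fL mI I1; rewrite (Lnorm_fin s0 fL) -lee_fin => /le_trans; apply.
rewrite -EFinM [leRHS]EFinM; apply: lee_wpmul2l => //.
by rewrite lee_fin mulr_ge0 ?Lsnorm_ge0 // ltW.
Qed.

End Equivalences.

(** * Change of density *)

Section Density.
Context (d : measure_display) (X : measurableType d) (R : realType).
Context (mu : {measure set X -> \bar R}) (q s r : R) (q0 : 0 < q) (lt_qs : q < s) (r0 : 0 < r).
Context (Y : lmodType R) (N : Y -> R) (rBanachY : is_r_Banach r N).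
Context (T : (X -> R) -> Y) (T_bl : is_bounded_linear mu s N T).
Context (w : X -> R) (w_int : mu.-integrable setT (EFin \o w)) (w_ge0 : forall x, 0 <= w x).
Implicit Types (f g h : X -> R) (E A B : set X) (nu : set X -> \bar R).

Local Notation Ls := (Lfun mu s%:E).

Let s0 : 0 < s. Proof. exact: lt_trans lt_qs. Qed.

Let th0 : 0 < q^-1 - s^-1.
Proof. by rewrite subr_gt0 ltf_pV2 ?posrE. Qed.

Let mw : measurable_fun setT w.
Proof. by apply/measurable_EFinP; have /integrableP[] := w_int. Qed.

Lemma finite_monotone_weighted : finite_monotone (weighted mu w).
Proof.
split=> [A mA|A B mA mB AB]; last first.
  apply: ge0_subset_integral => //; first exact/measurable_EFinP/measurable_funTS.
  by move=> x _; rewrite lee_fin.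
split; last by apply: integral_ge0 => x _; rewrite lee_fin.
by apply: integrable_fin_num => //; exact: integrableS w_int.
Qed.

(** The map from f to f * w `^ (- s^-1) turns the L_s quasi-norm for mu into
    the one for w mu, at least where w is positive. *)
Definition density_quotient f : X -> R := fun x => f x * w x `^ (- s^-1).

Lemma measurable_density_quotient f : measurable_fun setT f ->
  measurable_fun setT (density_quotient f).
Proof.
move=> mf; apply: measurable_funM => //.
exact: (measurableT_comp (measurable_powR _)).
Qed.

Lemma density_quotient_pos f x : density_quotient f x != 0 -> 0 < w x.
Proof.
move=> h; rewrite lt_neqAle w_ge0 andbT eq_sym; apply: contraNneq h => wx.
by rewrite /density_quotient wx powR0 ?mulr0 // oppr_eq0 invr_eq0 gt_eqF.
Qed.

Lemma density_quotient_powR f x : 0 < w x ->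
  `|density_quotient f x| `^ s * w x = `|f x| `^ s.
Proof.
move=> wx; rewrite /density_quotient normrM powRM // (ger0_norm (powR_ge0 _ _)).
rewrite -powRrM mulNr mulVf ?gt_eqF // powR_inv1 ?(ltW wx) //.
by rewrite mulfVK // gt_eqF.
Qed.

(** On this level set |f| `^ s is at most (2 * y) `^ s * w. *)
Lemma Lsnorm_level_le f y : 0 < y -> f \in Ls ->
  let E := level (density_quotient f) y (2 * y) in
  Lsnorm mu s (cutoff f E) <= 2 * y * fine (weighted mu w E) `^ s^-1.
Proof.
move=> y0 fL /=; set E := level _ _ _; have mf := Lfun_measurable s0 fL.
have mE : measurable E by apply: measurable_level; exact: measurable_density_quotient.
have [fin W0] := finite_monotone_weighted.1 E mE.
have [fE _] := Lfun_cutoff s0 fL mE.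
have y2 : 0 <= 2 * y by rewrite mulr_ge0 // ltW.
have I : (Lsint mu s (cutoff f E) <= ((2 * y) `^ s)%:E * weighted mu w E)%E.
  rewrite (Lsint_cutoff _ s0 _ mE) /weighted -ge0_integralZl //.
  - apply: ge0_le_integral_nonmeasurable => x; rewrite /E /level /= => xE.
      by rewrite lee_fin powR_ge0.
    have /andP[h1 h2] := xE.
    have wx : 0 < w x.
      by apply: (@density_quotient_pos f); rewrite -normr_gt0; exact: lt_trans h1.
    rewrite -EFinM lee_fin -(density_quotient_powR f wx) ler_wpM2r //.
    by rewrite ge0_ler_powR ?nnegrE ?(ltW s0).
  - exact/measurable_EFinP/measurable_funTS.
  - by move=> x _; rewrite lee_fin.
  - by rewrite lee_fin powR_ge0.
rewrite LsnormE.
have -> : 2 * y * fine (weighted mu w E) `^ s^-1 =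
    fine (((2 * y) `^ s)%:E * weighted mu w E)%E `^ s^-1.
  rewrite fineM //= powRM ?powR_ge0 ?fine_ge0 // -powRrM divff ?gt_eqF //.
  by rewrite powRr1.
rewrite ge0_ler_powR ?nnegrE ?invr_ge0 ?(ltW s0) ?fine_ge0 ?Lsint_ge0 //.
  by rewrite mule_ge0 // lee_fin powR_ge0.
by rewrite fine_le ?fin_numM // (Lsint_fin s0).
Qed.

(** Dyadic decomposition of f along the level sets of its density quotient
    h. On the level between y and 2 * y the quasi-norm of f contributes y
    times the power s^-1 of the measure of the level, and the set estimate
    contributes the missing power q^-1 - s^-1. Where h vanishes either f or
    w does, and the set where w = 0 has measure 0 for w mu, so the set
    estimate makes T vanish there. *)
Lemma set_bound_factorization C : 0 < C -> set_bound mu q s N T (weighted mu w) C ->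
  exists2 C', 0 < C' & forall f, f \in Ls ->
    ((N (T f))%:E <= C'%:E * lorentz_norm q r (weighted mu w) (density_quotient f))%E.
Proof.
move=> C0 hC; have W := finite_monotone_weighted.
pose K : R := (2 `^ r / (2 `^ r - 1)) `^ r^-1.
have K0 : 0 < K by rewrite powR_gt0 // divr_gt0 ?powR_gt0 // subr_gt0 powR2_gt1.
exists (K * (2 * C)); first by rewrite !mulr_gt0.
move=> f fL; have mf := Lfun_measurable s0 fL; rewrite EFinM.
have mh := measurable_density_quotient mf.
apply: (op_lorentz_le s0 r0 rBanachY T_bl q0 _ W fL mh).
- by rewrite mulr_ge0 // ltW.
- have mZ : measurable [set x | w x = 0].
    have -> : [set x | w x = 0] = setT `&` w @^-1` [set 0].
      by apply/seteqP; split=> x //= -[].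
    by apply: mw => //; exact: measurable_set1.
  have <- : T (cutoff f [set x | w x = 0]) = T (cutoff f [set x | density_quotient f x = 0]).
    apply: op_ext => x; rewrite /cutoff !indicE.
    have [->|fx] := eqVneq (f x) 0; first by rewrite !mul0r.
    congr (_ * (nat_of_bool _)%:R); apply/idP/idP => /set_mem /= h; apply/mem_set => /=.
      by rewrite /density_quotient h powR0 ?mulr0 // oppr_eq0 invr_eq0 gt_eqF.
    move/eqP: h; rewrite /density_quotient mulf_eq0 (negbTE fx) /= powR_eq0.
    by case/andP => /eqP.
  have [[_ N0 _ _] _ _] := rBanachY; apply: N0; apply/eqP; rewrite eq_le.
  rewrite (qnorm_nonneg rBanachY) andbT; apply: le_trans (hC _ _ fL mZ) _.
  rewrite /weighted (eq_integral (cst 0%E)) ?integral0 /=; last by move=> x /set_mem /= ->.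
  by rewrite powR0 ?mulr0 // gt_eqF.
move=> y y0; set E := level _ _ _.
have mE : measurable E by exact: measurable_level.
have [fin W0] := W.1 E mE; have nuE0 : 0 <= fine (weighted mu w E) by rewrite fine_ge0.
apply: le_trans (set_bound_cutoff q0 lt_qs hC fL mE) _.
apply: (@le_trans _ _ (2 * C * y * fine (weighted mu w E) `^ q^-1)); last first.
  rewrite ler_wpM2l //; first by rewrite !mulr_ge0 // ltW.
  by apply: fine_level_le => //; rewrite invr_ge0 ltW.
have -> : fine (weighted mu w E) `^ q^-1 =
    fine (weighted mu w E) `^ s^-1 * fine (weighted mu w E) `^ (q^-1 - s^-1).
  have e : s^-1 + (q^-1 - s^-1) = q^-1 by rewrite addrC subrK.
  by rewrite -powRD e // invr_eq0 gt_eqF.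
rewrite mulrA ler_wpM2r ?powR_ge0 //.
have := Lsnorm_level_le y0 fL; rewrite /= -/E => /(ler_wpM2l (ltW C0)) /le_trans; apply.
by rewrite le_eqVlt; apply/orP; left; apply/eqP; ring.
Qed.

(** Markov's inequality for |h| `^ s, where h is the density quotient. *)
Lemma weighted_markov f z : 0 < z -> f \in Ls ->
  fine (weighted mu w [set x | z < `|density_quotient f x|]) <= (Lsnorm mu s f / z) `^ s.
Proof.
move=> z0 fL; have mf := Lfun_measurable s0 fL.
have mh := measurable_density_quotient mf.
set G := [set x | _]; have mG : measurable G by exact: measurable_norm_gt.
have [fin W0] := finite_monotone_weighted.1 G mG.
have zs : 0 < z `^ s by rewrite powR_gt0.
rewrite powRM ?Lsnorm_ge0 ?invr_ge0 ?(ltW z0) // Lsnorm_powR //.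
rewrite -powR_inv1 ?(ltW z0) // powRAC powR_inv1 ?(ltW zs) // ler_pdivlMr //.
rewrite -lee_fin EFinM !fineK ?(Lsint_fin s0) // muleC /weighted -ge0_integralZl //.
- apply: (@le_trans _ _ (\int[mu]_(x in G) (`|f x| `^ s)%:E)%E).
    apply: ge0_le_integral_nonmeasurable => x; rewrite /G /= => xG.
      by rewrite mule_ge0 ?lee_fin ?powR_ge0.
    have wx : 0 < w x.
      by apply: (@density_quotient_pos f); rewrite -normr_gt0; exact: lt_trans xG.
    rewrite -EFinM lee_fin -(density_quotient_powR f wx) ler_wpM2r //.
    by rewrite ge0_ler_powR ?nnegrE ?(ltW s0) ?(ltW z0) // ltW.
  apply: ge0_subset_integral => //; first exact: measurable_powR_norm.
- exact/measurable_EFinP/measurable_funTS.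
- by move=> x _; rewrite lee_fin.
- by rewrite lee_fin powR_ge0.
Qed.

(** The density quotient of f cut off at E has rearrangement at most a
    multiple of u `^ (- s^-1) by Markov's inequality, and 0 beyond the
    measure of E. *)
Lemma factorization_set_bound C : 0 < C ->
  (forall f, f \in Ls ->
    ((N (T f))%:E <= C%:E * lorentz_norm q r (weighted mu w) (density_quotient f))%E) ->
  exists2 C', 0 < C' & set_bound mu q s N T (weighted mu w) C'.
Proof.
move=> C0 hC; have [wfin wmon] := finite_monotone_weighted.
pose K : R := (q^-1 / (q^-1 - s^-1)) `^ r^-1.
have K0 : 0 < K by rewrite powR_gt0 // divr_gt0 // invr_gt0.
exists (C * K); first exact: mulr_gt0.
move=> f E fL mE; have [fE le_fE] := Lfun_cutoff s0 fL mE.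
have nf0 := Lsnorm_ge0 mu s f; have [finE W0] := wfin _ mE.
have [M M0 hM] := op_bounded s0 T_bl.
(* The weak-type bound needs a positive threshold, so functions that vanish
   almost everywhere are treated apart. *)
have := nf0; rewrite le_eqVlt => /predU1P[nf|nf].
  rewrite -nf mulr0 mul0r; apply: le_trans (hM _ fE) _.
  apply: le_trans (ler_wpM2l M0 le_fE) _; by rewrite -nf mulr0.
have L : (lorentz_norm q r (weighted mu w) (density_quotient (cutoff f E)) <=
  (K * Lsnorm mu s f * fine (weighted mu w E) `^ (q^-1 - s^-1))%:E)%E.
  apply: lorentz_norm_le => //.
  - by rewrite -subr_gt0.
  - by rewrite fine_ge0.
  - move=> u u0 _; set z := Lsnorm mu s f * u `^ (- s^-1).
    have z0 : 0 < z by rewrite mulr_gt0 // powR_gt0.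
    have mG : measurable [set x | z < `|density_quotient (cutoff f E) x|].
      by apply: measurable_norm_gt; apply: measurable_density_quotient; exact: (Lfun_measurable s0 fE).
    have [finG G0] := wfin _ mG.
    apply: ge_ereal_inf; exists (maxe 0 (ereal_sup [set (`|density_quotient (cutoff f E) x|)%:E |
        x in ~` [set x | (z < `|density_quotient (cutoff f E) x|)%R]]))%E.
      exists [set x | z < `|density_quotient (cutoff f E) x|] => //; split=> //.
      rewrite -(fineK finG) lee_fin; apply: le_trans (weighted_markov z0 fE) _.
      apply: (@le_trans _ _ ((Lsnorm mu s f / z) `^ s)).
        apply: ge0_ler_powR; rewrite ?nnegrE ?divr_ge0 ?Lsnorm_ge0 ?(ltW z0) ?(ltW s0) //.
        by rewrite ler_wpM2r // invr_ge0 ltW.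
      rewrite /z invfM mulrA divff ?gt_eqF // mul1r powRN invrK -powRrM mulVf ?gt_eqF //.
      by rewrite powRr1 // ltW.
    rewrite ge_max lee_fin (ltW z0) /=; apply: ge_ereal_sup => _ [x xG <-].
    by rewrite lee_fin leNgt; exact/negP.
  - move=> u u0 Eu; apply: (rearrangement_le0 mE).
      by rewrite -(fineK finE) lee_fin.
    by move=> x Ex; rewrite /density_quotient /cutoff indicE memNset // mulr0 mul0r.
have := hC _ fE; rewrite -lee_fin => /le_trans; apply.
rewrite -!mulrA EFinM mulrA; apply: lee_wpmul2l => //.
by rewrite lee_fin ltW.
Qed.

End Density.

(** * From a set estimate to disjoint sums *)

(** Young's inequality for the normalized terms, summed up. *)
Lemma sum_powR_hoelder (R : realType) (I : finType) (a b : I -> R) (al : R) :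
  0 < al < 1 -> (forall i, 0 <= a i) -> (forall i, 0 <= b i) ->
  \sum_i a i `^ al * b i `^ (1 - al) <= (\sum_i a i) `^ al * (\sum_i b i) `^ (1 - al).
Proof.
move=> /andP[al0 al1] a0 b0.
have be0 : 0 < 1 - al by rewrite subr_gt0.
have [A0|A0] := eqVneq (\sum_i a i) 0.
  rewrite big1 ?mulr_ge0 ?powR_ge0 // => i _.
  have /allP/(_ i) : all (fun i => (a i == 0)) (index_enum I).
    by move/eqP: A0; rewrite psumr_eq0.
  by rewrite mem_index_enum => /(_ isT)/eqP ->; rewrite powR0 ?mul0r // gt_eqF.
have [B0|B0] := eqVneq (\sum_i b i) 0.
  rewrite big1 ?mulr_ge0 ?powR_ge0 // => i _.
  have /allP/(_ i) : all (fun i => (b i == 0)) (index_enum I).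
    by move/eqP: B0; rewrite psumr_eq0.
  by rewrite mem_index_enum => /(_ isT)/eqP ->; rewrite powR0 ?mulr0 // gt_eqF.
set A := \sum_i a i in A0 *; set B := \sum_i b i in B0 *.
have Apos : 0 < A by rewrite lt_neqAle eq_sym A0 sumr_ge0.
have Bpos : 0 < B by rewrite lt_neqAle eq_sym B0 sumr_ge0.
have young i : a i `^ al * b i `^ (1 - al) <=
    A `^ al * B `^ (1 - al) * (al * (a i / A) + (1 - al) * (b i / B)).
  have aA : 0 <= a i / A by rewrite divr_ge0 // ltW.
  have bB : 0 <= b i / B by rewrite divr_ge0 // ltW.
  have ea : a i = a i / A * A by rewrite divfK.
  have eb : b i = b i / B * B by rewrite divfK.
  rewrite {1}ea {1}eb (powRM _ aA (ltW Apos)) (powRM _ bB (ltW Bpos)).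
  rewrite mulrACA mulrC ler_wpM2l ?mulr_ge0 ?powR_ge0 //.
  have := @conjugate_powR R ((a i / A) `^ al) ((b i / B) `^ (1 - al)) al^-1 (1 - al)^-1.
  rewrite !powR_ge0 !invr_gt0 al0 be0 !invrK subrKC => /(_ isT isT isT isT erefl).
  rewrite -!powRrM !divff ?gt_eqF // !powRr1 //.
  by rewrite [_ * al]mulrC [_ * (1 - al)]mulrC.
apply: le_trans (ler_sum _ (fun i _ => young i)) _.
rewrite -mulr_sumr big_split /= -!mulr_sumr -!mulr_suml -/A -/B !divff // !mulr1.
by rewrite subrKC mulr1.
Qed.

Section UpperEstimate.
Context (d : measure_display) (X : measurableType d) (R : realType).
Context (mu : {measure set X -> \bar R}) (q s r : R) (q0 : 0 < q) (lt_qs : q < s) (r0 : 0 < r).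
Context (Y : lmodType R) (N : Y -> R) (rBanachY : is_r_Banach r N).
Context (T : (X -> R) -> Y) (T_bl : is_bounded_linear mu s N T).
Implicit Types (f g h : X -> R) (E A B : set X) (nu : set X -> \bar R).

Local Notation Ls := (Lfun mu s%:E).

Let s0 : 0 < s. Proof. exact: lt_trans lt_qs. Qed.

Let th0 : 0 < q^-1 - s^-1.
Proof. by rewrite subr_gt0 ltf_pV2 ?posrE. Qed.

(** The functions are moved to disjoint pieces of their supports and
    Hoelder's inequality is applied to the sum of the (x i `^ s) `^ (q / s)
    * l i `^ (1 - q / s), where x i are the quasi-norms and l i the measures
    of the pieces. *)
Lemma set_bound_upper nu C : 0 < C ->
  (forall n (A : 'I_n -> set X), (forall i, measurable (A i)) ->
     (forall i j, i != j -> A i `&` A j = set0) -> \sum_i fine (nu (A i)) <= 1) ->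
  (forall A, measurable A -> 0 <= fine (nu A)) ->
  set_bound mu q s N T nu C -> upper_estimate mu N T q s.
Proof.
move=> C0 nu1 nu0 hC; exists C; split=> // n f fL fD.
pose F x := \sum_(i < n) `|f i x|.
have mF : measurable_fun setT F.
  apply: measurable_sum => i; apply: measurableT_comp => //; exact: (Lfun_measurable s0 (fL i)).
(* When the sum of the |f i| is not in L_s the right-hand side is infinite. *)
have [FL|FL] := boolP (F \in Ls); last first.
  suff -> : ('N[mu]_s%:E [EFin \o F] = +oo)%E by rewrite gt0_muley ?leey.
  apply/eqP; rewrite -leye_eq leNgt; apply: contra FL => fin.
  apply/(LfunE _ s0); split=> //.
  have sV : s^-1 != 0 by rewrite invr_eq0 gt_eqF.
  by apply: (lty_poweRy sV); rewrite -LnormE.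
rewrite (Lnorm_fin s0 FL) -EFinM lee_fin.
pose supp i := [set x | f i x != 0].
have msupp i : measurable (supp i).
  have -> : supp i = setT `&` f i @^-1` (~` [set 0]).
    by apply/seteqP; split=> x /=; rewrite /supp /=; [move/eqP|case=> _ /eqP].
  by apply: (Lfun_measurable s0 (fL i)) => //; apply: measurableC; exact: measurable_set1.
(* The supports are only disjoint up to null sets; subtracting the earlier
   ones makes them disjoint and leaves the classes of the functions
   unchanged. *)
pose A i := supp i `\` \big[setU/set0]_(j < n | (j < i)%N) supp j.
have mA i : measurable (A i).
  by apply: measurableD => //; apply: bigsetU_measurable.
have dA i j : i != j -> A i `&` A j = set0.
  wlog lt : i j / (i < j)%N => [wl ij|_].
    have [lt|lt|/val_inj eq] := ltngtP i j; first exact: wl.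
      by rewrite setIC wl // eq_sym.
    by rewrite eq eqxx in ij.
  apply/seteqP; split=> x //= -[[fx _] [_]]; apply.
  by rewrite -bigcup_seq_cond; exists i => //=; rewrite mem_index_enum.
have TA i : T (f i) = T (cutoff (f i) (A i)).
  have [Tae _ _] := T_bl; apply: Tae => //.
    by have [] := Lfun_cutoff s0 (fL i) (mA i).
  have : {ae mu, forall x, forall j : 'I_n, j \in enum 'I_n -> (j < i)%N -> f i x = 0 \/ f j x = 0}.
    elim: (enum 'I_n) => [|j l IH]; first exact: nearW.
    have [ji|ji] := boolP (j < i)%N; last first.
      apply: filterS IH => x hx k; rewrite inE => /predU1P[->|kl]; last exact: hx.
      by rewrite (negbTE ji).
    have ij : i != j by apply: contraTneq ji => ->; rewrite ltnn.
    apply: filterS2 IH (fD i j ij) => x hx hj k; rewrite inE => /predU1P[->//|kl].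
    exact: hx.
  apply: filterS => x hx; rewrite /cutoff indicE.
  have [->|fx] := eqVneq (f i x) 0; first by rewrite mul0r.
  rewrite mem_set ?mulr1 //; split=> //; rewrite -bigcup_seq_cond => -[j /= /andP[_ ji] fj].
  have [fi|fj'] := hx j (mem_enum _ _) ji; first by rewrite fi eqxx in fx.
  by move: fj; rewrite /supp /= fj' eqxx.
pose x i := Lsnorm mu s (cutoff (f i) (A i)).
pose l i := fine (nu (A i)).
have x0 i : 0 <= x i by exact: Lsnorm_ge0.
have l0 i : 0 <= l i by exact: nu0.
have bound i : N (T (f i)) <= C * x i * l i `^ (q^-1 - s^-1).
  by rewrite TA; exact: (set_bound_cutoff q0 lt_qs hC (fL i) (mA i)).
have sumx : \sum_i x i `^ s <= Lsnorm mu s F `^ s.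
  apply: le_trans (Lsnorm_cutoff_sum s0 FL mA dA); apply: ler_sum => i _.
  apply: ge0_ler_powR; rewrite ?nnegrE ?Lsnorm_ge0 ?(ltW s0) //.
  have [FA _] := Lfun_cutoff s0 FL (mA i).
  have mfA : measurable_fun setT (cutoff (f i) (A i)).
    by apply: measurable_cutoff => //; exact: (Lfun_measurable s0 (fL i)).
  apply: (Lfun_le s0 FA mfA _).2 => y; rewrite /cutoff !normrM ler_wpM2r //.
  rewrite [leRHS]ger0_norm ?sumr_ge0 // /F (bigD1 i) //= lerDl; exact: sumr_ge0.
pose al := q / s.
have al0 : 0 < al by rewrite divr_gt0.
have al1 : al < 1 by rewrite ltr_pdivrMr // mul1r.
have qth : q * (q^-1 - s^-1) = 1 - al by rewrite mulrBr divff ?gt_eqF.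
have sumN : \sum_i N (T (f i)) `^ q <= C `^ q * (\sum_i (x i `^ s) `^ al * l i `^ (1 - al)).
  rewrite mulr_sumr; apply: ler_sum => i _.
  have -> : C `^ q * ((x i `^ s) `^ al * l i `^ (1 - al)) =
      (C * x i * l i `^ (q^-1 - s^-1)) `^ q.
    rewrite !powRM ?mulr_ge0 ?powR_ge0 ?(ltW C0) // -!powRrM.
    have -> : s * al = q by rewrite /al mulrCA divff ?mulr1 ?gt_eqF.
    by rewrite [_ * q]mulrC qth mulrA.
  apply: ge0_ler_powR; rewrite ?nnegrE ?(qnorm_nonneg rBanachY) ?(ltW q0) //.
  by rewrite !mulr_ge0 ?powR_ge0 // ltW.
have al01 : 0 < al < 1 by rewrite al0 al1.
have H := sum_powR_hoelder al01 (fun i => powR_ge0 (x i) s) l0.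
have main : \sum_i N (T (f i)) `^ q <= (C * Lsnorm mu s F) `^ q.
  apply: le_trans sumN _; rewrite powRM ?Lsnorm_ge0 ?(ltW C0) // ler_wpM2l ?powR_ge0 //.
  apply: le_trans H _; apply: (@le_trans _ _ ((Lsnorm mu s F `^ s) `^ al * 1)).
    apply: ler_pM; rewrite ?powR_ge0 //.
      by apply: ge0_ler_powR; rewrite ?nnegrE ?(ltW al0) ?powR_ge0 ?sumr_ge0 // => i _; rewrite powR_ge0.
    have o : 1 `^ (1 - al) = 1 :> R by rewrite powR1.
    rewrite -[leRHS]o; apply: ge0_ler_powR; rewrite ?nnegrE ?subr_ge0 ?(ltW al1) ?sumr_ge0 //.
    exact: nu1.
  rewrite mulr1 -powRrM.
  by have -> : s * al = q by rewrite /al mulrCA divff ?mulr1 ?gt_eqF.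
have -> : C * Lsnorm mu s F = ((C * Lsnorm mu s F) `^ q) `^ q^-1.
  by rewrite -powRrM divff ?gt_eqF // powRr1 // mulr_ge0 ?Lsnorm_ge0 // ltW.
apply: ge0_ler_powR; rewrite ?nnegrE ?invr_ge0 ?(ltW q0) ?powR_ge0 ?sumr_ge0 //.
by move=> i _; rewrite powR_ge0.
Qed.

End UpperEstimate.

(** * From disjoint sums to a set estimate *)

Lemma powRV (R : realType) (a x : R) : 0 <= a -> a^-1 `^ x = (a `^ x)^-1.
Proof. by move=> a0; rewrite -powR_inv1 // -powRrM mulN1r powRN. Qed.

Section Domination.
Context (d : measure_display) (X : measurableType d) (R : realType).
Context (mu : {measure set X -> \bar R}) (q s r : R) (q0 : 0 < q) (lt_qs : q < s) (r0 : 0 < r).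
Context (Y : lmodType R) (N : Y -> R) (rBanachY : is_r_Banach r N).
Context (T : (X -> R) -> Y) (T_bl : is_bounded_linear mu s N T).
Implicit Types (f g h : X -> R) (E A B : set X) (nu : set X -> \bar R).

Local Notation Ls := (Lfun mu s%:E).

Let s0 : 0 < s. Proof. exact: lt_trans lt_qs. Qed.

Let th0 : 0 < q^-1 - s^-1.
Proof. by rewrite subr_gt0 ltf_pV2 ?posrE. Qed.

Let t := (q^-1 - s^-1)^-1.

Let t0 : 0 < t. Proof. by rewrite invr_gt0. Qed.

Definition op_values E : set R :=
  [set N (T (cutoff f E)) | f in [set f | f \in Ls /\ Lsnorm mu s f <= 1]].

(** The norm of T on functions supported in E. *)
Definition op_size E : R := sup (op_values E).

Lemma Lfun_zero : (fun=> 0 : R) \in Ls /\ Lsnorm mu s (fun=> 0 : R) = 0.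
Proof.
have I0 : Lsint mu s (fun=> 0) = 0%E.
  rewrite /Lsint (eq_integral (cst 0%E)) ?integral0 // => x _.
  by rewrite normr0 powR0 // gt_eqF.
split; first by apply/(LfunE _ s0); split; [exact: measurable_cst|rewrite I0].
by rewrite LsnormE I0 powR0 // invr_eq0 gt_eqF.
Qed.

Lemma op_values_sup E : measurable E -> has_sup (op_values E).
Proof.
move=> mE; have [zL z0] := Lfun_zero; split.
  by exists (N (T (cutoff (fun=> 0) E))), (fun=> 0) => //; split=> //; rewrite z0.
have [M M0 hM] := op_bounded s0 T_bl.
exists M => _ [f [fL f1] <-]; have [fE le_fE] := Lfun_cutoff s0 fL mE.
apply: le_trans (hM _ fE) _; rewrite ler_piMr //; exact: le_trans le_fE f1.
Qed.

Lemma op_size_ub E f : measurable E -> f \in Ls -> Lsnorm mu s f <= 1 ->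
  N (T (cutoff f E)) <= op_size E.
Proof.
move=> mE fL f1; apply: sup_upper_bound; first exact: op_values_sup.
by exists f.
Qed.

Lemma op_size_ge0 E : measurable E -> 0 <= op_size E.
Proof.
move=> mE; have [zL z0] := Lfun_zero.
apply: le_trans (op_size_ub mE zL _); last by rewrite z0.
exact: (qnorm_nonneg rBanachY).
Qed.

Lemma op_size0 : op_size set0 = 0.
Proof.
apply/eqP; rewrite eq_le op_size_ge0 // andbT.
apply: ge_sup; first by have [] := op_values_sup measurable0.
by move=> _ [f [fL _] <-]; rewrite (op_cutoff0 s0 T_bl fL) (qnorm0 rBanachY).
Qed.

(** Subadditivity of the r-th power of N only; the constant is harmless
    because packings tolerate any constant of quasi-subadditivity. *)
Lemma op_sizeU A B : measurable A -> measurable B -> A `&` B = set0 ->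
  op_size (A `|` B) <= 2 `^ r^-1 * Num.max (op_size A) (op_size B).
Proof.
move=> mA mB AB; apply: ge_sup.
  by have [] := op_values_sup (measurableU _ _ mA mB).
move=> _ [f [fL f1] <-]; set m := Num.max _ _.
have m0 : 0 <= m by rewrite le_max op_size_ge0.
have h : N (T (cutoff f (A `|` B))) `^ r <= 2 * m `^ r.
  apply: le_trans (op_cutoff_powD s0 rBanachY T_bl fL mA mB AB) _.
  rewrite mulr2n mulrDl !mul1r; apply: lerD; apply: ge0_ler_powR;
    rewrite ?nnegrE ?(ltW r0) ?(qnorm_nonneg rBanachY) // le_max.
    by rewrite op_size_ub.
  by rewrite (op_size_ub mB) // orbT.
have := @ge0_ler_powR _ r^-1 _ _ _ _ _ h.
rewrite -powRrM divff ?gt_eqF // powRr1 ?(qnorm_nonneg rBanachY) //.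
rewrite powRM ?powR_ge0 // -powRrM divff ?gt_eqF // powRr1 //; apply.
- by rewrite invr_ge0 ltW.
- by rewrite nnegrE powR_ge0.
- by rewrite nnegrE mulr_ge0 ?powR_ge0.
Qed.

(** Near-extremal functions f i on the sets A i, with b i the value
    attained, are scaled by b i `^ (t / s), the choice for which Hoelder's
    inequality with exponents q, s and t is an equality. The upper estimate
    then bounds the sum S of the b i `^ t by S `^ q^-1 <= C * S `^ s^-1. The
    factor 2 pays for the suprema not being attained. *)
Lemma op_size_disjoint C : 0 < C ->
  (forall (n : nat) (f : 'I_n -> X -> R), (forall i, f i \in Ls) ->
      (forall i j, i != j -> {ae mu, forall x, f i x = 0 \/ f j x = 0}) ->
      (((\sum_(i < n) N (T (f i)) `^ q) `^ q^-1)%:E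
        <= C%:E * 'N[mu]_s%:E [EFin \o (fun x => (\sum_(i < n) `|f i x|)%R)])%E) ->
  forall n (A : 'I_n -> set X), (forall i, measurable (A i)) ->
    (forall i j, i != j -> A i `&` A j = set0) ->
  \sum_i (op_size (A i) / (2 * C)) `^ t <= 1.
Proof.
move=> C0 hC n A mA dA.
have choice i : exists f, [/\ f \in Ls, Lsnorm mu s f <= 1 &
    op_size (A i) / 2 <= N (T (cutoff f (A i)))].
  have := op_size_ge0 (mA i); rewrite le_eqVlt => /predU1P[<-|pos].
    have [zL z0] := Lfun_zero; exists (fun=> 0); rewrite z0; split=> //.
    by rewrite mul0r (qnorm_nonneg rBanachY).
  have h2 : 0 < op_size (A i) / 2 by rewrite divr_gt0.
  have [_ [f [fL f1] <-] hf] := sup_adherent h2 (op_values_sup (mA i)).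
  exists f; split=> //; apply: ltW; apply: le_lt_trans hf.
  rewrite -/(op_size _); lra.
pose f i := sval (cid (choice i)).
have fL i : f i \in Ls by rewrite /f; case: cid => ? [].
have f1 i : Lsnorm mu s (f i) <= 1 by rewrite /f; case: cid => ? [].
pose b i := N (T (cutoff (f i) (A i))).
have bP i : op_size (A i) / 2 <= b i by rewrite /b /f; case: cid => ? [].
have b0 i : 0 <= b i by exact: (qnorm_nonneg rBanachY).
suff sumb : \sum_i b i `^ t <= C `^ t.
  apply: (@le_trans _ _ (\sum_i b i `^ t / C `^ t)).
    apply: ler_sum => i _.
    have -> : b i `^ t / C `^ t = (b i / C) `^ t.
      by rewrite powRM ?invr_ge0 ?(ltW C0) // powRV ?(ltW C0).
    apply: ge0_ler_powR; rewrite ?nnegrE ?(ltW t0) ?divr_ge0 ?op_size_ge0 ?mulr_ge0 ?(ltW C0) //.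
    by rewrite invfM mulrA ler_wpM2r // invr_ge0 ltW.
  by rewrite -mulr_suml ler_pdivrMr ?powR_gt0 // mul1r.
pose a i := b i `^ (t / s).
pose F i x := a i * cutoff (f i) (A i) x.
have cL i : cutoff (f i) (A i) \in Ls /\ Lsnorm mu s (cutoff (f i) (A i)) <= Lsnorm mu s (f i).
  exact: (Lfun_cutoff s0 (fL i) (mA i)).
have FL i : F i \in Ls.
  by have [] := Lfun_mull s0 (a i) (cL i).1.
have Fdis i j : i != j -> {ae mu, forall x, F i x = 0 \/ F j x = 0}.
  move=> ij; apply: nearW => x; rewrite /F /cutoff !indicE.
  have [xi|_] := boolP (x \in A i); last by left; rewrite !mulr0.
  have [xj|_] := boolP (x \in A j); last by right; rewrite !mulr0.
  by have [] : set0 x by rewrite -(dA i j ij); split; exact/set_mem.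
have a0 i : 0 <= a i by exact: powR_ge0.
pose S := \sum_i b i `^ t.
have S0 : 0 <= S by apply: sumr_ge0 => i _; rewrite powR_ge0.
have NF i : N (T (F i)) = a i * b i.
  rewrite /F (op_scale s0 T_bl (a i) (cL i).1).
  by have [[_ _ -> _] _ _] := rBanachY; rewrite ger0_norm.
have normF : (Lsint mu s (fun x => (\sum_(i < n) `|F i x|)%R) <= S%:E)%E.
  have -> : Lsint mu s (fun x => (\sum_(i < n) `|F i x|)%R) = (\sum_(i < n) Lsint mu s (F i))%E.
    rewrite /Lsint -ge0_integral_sum //; last first.
    - by move=> i; apply: (measurable_powR_norm s measurableT); exact: (Lfun_measurable s0 (FL i)).
    apply: eq_integral => x _; rewrite sumEFin; congr EFin.
    have [[i xi]|nx] := pselect (exists i, A i x); last first.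
      have F0 i : F i x = 0.
        by rewrite /F /cutoff indicE memNset ?mulr0 // => xi; apply: nx; exists i.
      rewrite big1 => [|i _]; last by rewrite F0 normr0.
      by rewrite big1 ?normr0 ?powR0 ?gt_eqF // => i _; rewrite F0 normr0 powR0 // gt_eqF.
    have F0 j : j != i -> F j x = 0.
      move=> ji; rewrite /F /cutoff indicE memNset ?mulr0 // => xj.
      by have [] : set0 x by rewrite -(dA j i ji).
    rewrite (bigD1 i) //= big1 ?addr0 => [|j ji]; last by rewrite F0 // normr0.
    rewrite normr_id (bigD1 i) //= [X in _ + X]big1 ?addr0 // => j ji.
    by rewrite F0 // normr0 powR0 // gt_eqF.
  rewrite /S -sumEFin; apply: lee_sum => i _.
  rewrite -(fineK (Lsint_fin s0 (FL i))) -Lsnorm_powR // lee_fin.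
  have [_ ->] := Lfun_mull s0 (a i) (cL i).1.
  rewrite (ger0_norm (a0 i)) powRM ?Lsnorm_ge0 // /a -powRrM divfK ?gt_eqF //.
  rewrite ler_piMr ?powR_ge0 //.
  have o : 1 `^ s = 1 :> R by rewrite powR1.
  rewrite -o; apply: ge0_ler_powR; rewrite ?nnegrE ?(ltW s0) ?Lsnorm_ge0 //.
  exact: le_trans (cL i).2 (f1 i).
have powS i : N (T (F i)) `^ q = b i `^ t.
  rewrite NF powRM // /a -powRrM -powRD.
    congr (_ `^ _).
    have e : q * t^-1 = 1 - q / s by rewrite /t invrK mulrBr divff ?gt_eqF.
    have : q = t * (1 - q / s) by rewrite -e mulrCA divff ?mulr1 // gt_eqF.
    by move=> {2}->; rewrite mulrBr mulr1 mulrAC -mulrA mulrCA mulrA subrKC.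
  by rewrite gt_eqF // addr_gt0 // mulr_gt0 // divr_gt0.
have := hC n F FL Fdis; rewrite (eq_bigr _ (fun i _ => powS i)) -/S LnormE.
have sV0 : 0 <= s^-1 by rewrite invr_ge0 ltW.
have P1 : Lsint mu s (fun x => (\sum_(i < n) `|F i x|)%R) \in `[0%E, +oo%E].
  by rewrite in_itv /= leey Lsint_ge0.
have P2 : S%:E \in `[0%E, +oo%E] by rewrite in_itv /= leey lee_fin S0.
have := gt0_ler_poweR sV0 P1 P2 normF; rewrite poweR_EFin.
move=> h1 h2; have {h2} := le_trans h2 (lee_wpmul2l (_ : (0 <= C%:E)%E) h1).
rewrite lee_fin ltW // => /(_ isT); rewrite -EFinM lee_fin => h2.
move: S0; rewrite le_eqVlt => /predU1P[<-|Spos]; first exact: powR_ge0.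
have h3 : S `^ (q^-1 - s^-1) <= C.
  have := h2; have {1}-> : q^-1 = (q^-1 - s^-1) + s^-1 by rewrite subrK.
  rewrite powRD; last by rewrite (gt_eqF Spos) implybT.
  by rewrite ler_pM2r // powR_gt0.
have := @ge0_ler_powR _ t _ _ _ _ _ h3.
rewrite -powRrM divff ?gt_eqF // powRr1 ?(ltW Spos) //; apply.
- exact: ltW.
- by rewrite nnegrE powR_ge0.
- by rewrite nnegrE ltW.
Qed.


(** The power t, for which the sums over disjoint sets are bounded,
    normalized so that they are at most 1. *)
Definition op_charge (C : R) E : R := (op_size E / (2 * C)) `^ t.

Lemma op_chargeU C A B : 0 < C -> measurable A -> measurable B -> A `&` B = set0 ->
  op_charge C (A `|` B) <= 2 `^ (r^-1 * t) * (op_charge C A + op_charge C B).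
Proof.
move=> C0 mA mB AB.
have C2 : 0 <= (2 * C)^-1 by rewrite invr_ge0 mulr_ge0 // ltW.
have A0 := op_size_ge0 mA; have B0 := op_size_ge0 mB.
have m0 : 0 <= Num.max (op_size A) (op_size B) by rewrite le_max A0.
apply: (@le_trans _ _ ((2 `^ r^-1 * (Num.max (op_size A) (op_size B) / (2 * C))) `^ t)).
  apply: ge0_ler_powR; rewrite ?nnegrE ?(ltW t0) ?mulr_ge0 ?powR_ge0 //.
    by apply: op_size_ge0; exact: measurableU.
  by rewrite mulrA ler_wpM2r // op_sizeU.
rewrite powRM ?powR_ge0 ?mulr_ge0 // -powRrM ler_wpM2l ?powR_ge0 // /op_charge.
by have [_|_] := leP (op_size A) (op_size B); rewrite ?lerDl ?lerDr powR_ge0.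
Qed.

Lemma additive_cover_le (l : set X -> R) E (B : nat -> set X) n :
  (forall A, measurable A -> 0 <= l A) -> l set0 = 0 ->
  (forall A B, measurable A -> measurable B -> A `&` B = set0 -> l (A `|` B) = l A + l B) ->
  measurable E -> (forall k, measurable (B k)) ->
  l (E `&` \big[setU/set0]_(k < n) B k) <= \sum_(k < n) l (B k).
Proof.
move=> l_ge0 l0 lU mE mB.
have lmon A A' : measurable A -> measurable A' -> A `<=` A' -> l A <= l A'.
  move=> mA mA' AA'; rewrite -(setDUK AA') lU ?lerDl ?l_ge0 //; try exact: measurableD.
  by apply/seteqP; split=> x //= -[? []].
elim: n => [|n IH]; first by rewrite !big_ord0 setI0 l0.
rewrite !big_ord_recr /=; set U := \big[setU/set0]_(_ < _) _.
have mU : measurable U by apply: bigsetU_measurable.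
have -> : E `&` (U `|` B n) = (E `&` U) `|` ((E `&` B n) `\` U).
  apply/seteqP; split=> x /=.
    move=> [Ex [Ux|Bx]]; first by left.
    by have [Ux|Ux] := pselect (U x); [left|right].
  by move=> [[Ex Ux]|[[Ex Bx] _]]; split=> //; [left|right].
have mEB : measurable ((E `&` B n) `\` U).
  by apply: measurableD => //; exact: measurableI.
rewrite lU //; [|exact: measurableI|]; last first.
  by apply/seteqP; split=> x //= -[[_ Ux] [_]].
apply: lerD => //; apply: lmon => //.
by move=> x [[]].
Qed.

(** The set function op_charge has bounded packings, hence an additive
    majorant l, hence a countably additive nu below l. Although nu is
    smaller, it still dominates: for a countable cover of E the finite
    unions exhaust E, T is order continuous, and on finite unions l is
    subadditive. Normalizing nu gives the probability measure. *)
Lemma upper_set_bound : upper_estimate mu N T q s ->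
  exists (C : R) (P : probability X R), 0 < C /\ set_bound mu q s N T P C.
Proof.
move=> [C [C0 hC]].
pose K : R := 2 `^ (r^-1 * t).
have K1 : 1 <= K.
  have o : 2 `^ 0 = 1 :> R by rewrite powRr0.
  by rewrite -o /K ler_powR ?ler1n // mulr_ge0 ?invr_ge0 // ltW.
have eta_ge0 A : measurable A -> 0 <= op_charge C A by move=> _; exact: powR_ge0.
have eta0 : op_charge C set0 = 0 by rewrite /op_charge op_size0 mul0r powR0 // gt_eqF.
have bnd : packing_bounded (4 * K ^+ 2) (op_charge C).
  move=> p pk; apply: (packing_le K1 eta_ge0 eta0 _ _ pk).
    by move=> A B mA mB AB; exact: op_chargeU.
  exact: op_size_disjoint.
have [l [etal l0 lU]] := additive_majorant eta_ge0 bnd.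
have l_ge0 A : measurable A -> 0 <= l A.
  by move=> mA; apply: le_trans (etal _ mA); exact: eta_ge0.
have [nu nuE] := countably_additive_minorant l_ge0 l0 lU.
have nuT : (nu setT < +oo)%E.
  rewrite nuE //; apply: (@le_lt_trans _ _ (\sum_(k <oo) content_of l (if k is 0%N then setT else set0))%E).
    apply: ereal_inf_lbound; exists (fun k => if k is 0%N then setT else set0) => //.
    split=> [[|k] //|x _]; by exists 0%N.
  rewrite (nneseries_split 0 1) => [|k _]; last exact: content_of_ge0.
  rewrite eseries0 => [|[|k] // _ _]; last by rewrite /content_of l0 normr0.
  by rewrite adde0 big_nat1 ltry.
have [nufin numon] := finite_monotone_measure nuT.
have unit_ball_bound f E : f \in Ls -> Lsnorm mu s f <= 1 -> measurable E ->
    N (T (cutoff f E)) <= 2 * C * fine (nu E) `^ t^-1.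
  move=> fL f1 mE; have [finE nuE0] := nufin _ mE.
  have [fE le_fE] := Lfun_cutoff s0 fL mE.
  have Nf0 := qnorm_nonneg rBanachY (T (cutoff f E)).
  have C2 : 0 < 2 * C by rewrite mulr_gt0.
  suff main : (((N (T (cutoff f E)) / (2 * C)) `^ t)%:E <= nu E)%E.
    rewrite -ler_pdivrMl // mulrC; move: main; rewrite -(fineK finE) lee_fin => main.
    have := @ge0_ler_powR _ t^-1 _ _ _ _ _ main.
    rewrite -powRrM divff ?gt_eqF // powRr1 ?divr_ge0 ?(ltW C2) //; apply.
    - by rewrite invr_ge0 ltW.
    - by rewrite nnegrE powR_ge0.
    - by rewrite nnegrE fine_ge0.
  rewrite nuE //; apply: le_ereal_inf_tmp => _ [B [mB EB] <-].
  have {}mB k : measurable (B k) := mB k.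
  set sg := (\sum_(k <oo) _)%E.
  have sg_ge n : (\sum_(k < n) (l (B k))%:E <= sg)%E.
    have := @nneseries_lim_ge R (fun k => content_of l (B k)) xpredT 0%N n
      (fun k _ _ => content_of_ge0 l (B k)).
    rewrite big_mkord; rewrite (eq_bigr (fun k : 'I_n => (l (B k))%:E)) // => k _.
    by rewrite /content_of ger0_norm // l_ge0.
  case sgE : sg sg_ge => [sr| |] sg_ge; [|by rewrite leey|]; last first.
    by have := sg_ge 0%N; rewrite big_ord0.
  have sr0 : 0 <= sr by have := sg_ge 0%N; rewrite big_ord0 lee_fin.
  pose U n := E `&` \big[setU/set0]_(k < n) B k.
  have mU n : measurable (U n) by apply: measurableI => //; apply: bigsetU_measurable.
  have step n : N (T (cutoff f (U n))) <= 2 * C * sr `^ t^-1.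
    have h : (N (T (cutoff f (U n))) / (2 * C)) `^ t <= sr.
      apply: (@le_trans _ _ (op_charge C (U n))).
        apply: ge0_ler_powR; rewrite ?nnegrE ?(ltW t0) ?divr_ge0 ?op_size_ge0
           ?(qnorm_nonneg rBanachY) ?(ltW C2) //.
        by rewrite ler_wpM2r ?invr_ge0 ?(ltW C2) // op_size_ub.
      apply: le_trans (etal _ (mU n)) _.
      apply: le_trans (additive_cover_le n l_ge0 l0 lU mE mB) _.
      by rewrite -lee_fin -sumEFin sg_ge.
    rewrite -ler_pdivrMl // mulrC.
    have := @ge0_ler_powR _ t^-1 _ _ _ _ _ h.
    rewrite -powRrM divff ?gt_eqF // powRr1 ?divr_ge0 ?(ltW C2) ?(qnorm_nonneg rBanachY) //; apply.
    - by rewrite invr_ge0 ltW.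
    - by rewrite nnegrE powR_ge0.
    - by rewrite nnegrE.
  have lim : N (T (cutoff f E)) <= 2 * C * sr `^ t^-1.
    have V0 : 0 <= 2 * C * sr `^ t^-1 by rewrite mulr_ge0 ?powR_ge0 // ltW.
    suff h : N (T (cutoff f E)) `^ r <= (2 * C * sr `^ t^-1) `^ r.
      have := @ge0_ler_powR _ r^-1 _ _ _ _ _ h.
      rewrite -!powRrM !divff ?gt_eqF // !powRr1 //; apply.
      - by rewrite invr_ge0 ltW.
      - by rewrite nnegrE powR_ge0.
      - by rewrite nnegrE powR_ge0.
    apply/ler_addgt0Pr => e e0.
    have mEU n : measurable (E `\` U n) by exact: measurableD.
    have [n hn] : exists n, N (T (cutoff f (E `\` U n))) `^ r < e.
      apply: (op_small s0 r0 rBanachY T_bl fL e0 mEU) => x.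
      have [Ex|Ex] := pselect (E x); last by near=> n => -[].
      have [k _ Bk] := EB x Ex.
      near=> n => -[_]; apply; split=> //; rewrite -bigcup_mkord; exists k => //=.
      by near: n; exact: nbhs_infty_gt.
    have UE : U n `<=` E by move=> x [].
    rewrite -{1}(setDUK UE).
    apply: le_trans (op_cutoff_powD s0 rBanachY T_bl fL (mU n) (mEU n) _) _.
      by apply/seteqP; split=> x //= -[Ux [_]].
    apply: lerD; last exact: ltW.
    by apply: ge0_ler_powR; rewrite ?nnegrE ?(ltW r0) ?(qnorm_nonneg rBanachY).
  rewrite lee_fin.
  have h : N (T (cutoff f E)) / (2 * C) <= sr `^ t^-1 by rewrite ler_pdivrMr // mulrC.
  have := @ge0_ler_powR _ t _ _ _ _ _ h.
  rewrite -powRrM mulVf ?gt_eqF // powRr1 //; apply.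
  - exact: ltW.
  - by rewrite nnegrE divr_ge0 // ltW.
  - by rewrite nnegrE powR_ge0.
have op_nu_bound f E : f \in Ls -> measurable E ->
    N (T (cutoff f E)) <= 2 * C * Lsnorm mu s f * fine (nu E) `^ t^-1.
  move=> fL mE; have [fE le_fE] := Lfun_cutoff s0 fL mE.
  have [M M0 hM] := op_bounded s0 T_bl.
  have := Lsnorm_ge0 mu s f; rewrite le_eqVlt => /predU1P[nf|nf].
    rewrite -nf mulr0 mul0r; apply: le_trans (hM _ fE) _.
    apply: le_trans (ler_wpM2l M0 le_fE) _; by rewrite -nf mulr0.
  have [gL gN] := Lfun_mull s0 (Lsnorm mu s f)^-1 fL.
  have := unit_ball_bound _ E gL _ mE; rewrite gN ger0_norm ?invr_ge0 ?(ltW nf) // mulVf ?gt_eqF //.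
  move=> /(_ (lexx _)).
  have -> : T (cutoff (fun x => (Lsnorm mu s f)^-1 * f x) E) = (Lsnorm mu s f)^-1 *: T (cutoff f E).
    rewrite -(op_scale s0 T_bl _ fE); apply: op_ext => x; by rewrite /cutoff mulrA.
  have [[_ _ -> _] _ _] := rBanachY; rewrite ger0_norm ?invr_ge0 ?(ltW nf) //.
  rewrite -ler_pdivlMl ?invr_gt0 // invrK => /le_trans; apply.
  by rewrite mulrA [_ * (2 * C)]mulrC.
pose P0 : probability X R := dirac point.
pose P : probability X R := mnormalize nu P0.
(* If nu = 0 then T = 0 and any probability measure will do; the
   normalization then falls back on a point mass. *)
have [nuT0|nuT0] := eqVneq (nu setT) 0%E.
  exists 1, P; split=> // f E fL mE.
  apply: le_trans (op_nu_bound f E fL mE) _.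
  have -> : nu E = 0%E.
    have := numon _ _ mE measurableT (@subsetT _ E); rewrite nuT0 => nuE0.
    by apply/eqP; rewrite eq_le nuE0 measure_ge0.
  rewrite /= powR0 ?mulr0 ?mulr_ge0 ?powR_ge0 ?Lsnorm_ge0 //.
  by rewrite invr_eq0 gt_eqF.
have [finT _] := nufin _ measurableT.
have nT : 0 < fine (nu setT).
  by rewrite fine_gt0 // nuT andbT lt_neqAle eq_sym nuT0 measure_ge0.
exists (2 * C * fine (nu setT) `^ t^-1), P; split; first by rewrite !mulr_gt0 ?powR_gt0.
move=> f E fL mE; apply: le_trans (op_nu_bound f E fL mE) _.
have [finE nuE0] := nufin _ mE.
have -> : fine (nu E) = fine (nu setT) * fine (P E).
  rewrite /P /= /mnormalize (negbTE nuT0) /= lt_eqF //= fineM //=.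
  by rewrite mulrCA divff ?mulr1 // gt_eqF.
have PE0 : 0 <= fine (P E) by rewrite fine_ge0.
rewrite (powRM _ (ltW nT) PE0) /t invrK le_eqVlt; apply/orP; left; apply/eqP; ring.
Unshelve. all: by end_near. Qed.

End Domination.

(** * Dominating measures with a density *)

Section AbsoluteContinuity.
Context (d : measure_display) (X : measurableType d) (R : realType).
Context (mu : {measure set X -> \bar R}).

Lemma null_bigcup (Z : nat -> set X) : (forall n, measurable (Z n)) ->
  (forall n, mu (Z n) = 0%E) -> mu (\bigcup_n Z n) = 0%E.
Proof.
move=> mZ Z0; have mU : measurable (\bigcup_n Z n) by exact: bigcup_measurable.
apply: measure_negligible => //; apply: negligible_bigcup => n.
by exists (Z n); split.
Qed.

(** The supremum of the P-measures of mu-null sets is attained by a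
    countable union. Off this set P is absolutely continuous with respect to
    mu. *)
Lemma maximal_null_set (P : probability X R) :
  exists Z, [/\ measurable Z, mu Z = 0%E &
    forall A, measurable A -> mu A = 0%E -> P (A `\` Z) = 0%E].
Proof.
have Pfin A : measurable A -> P A \is a fin_num by move=> mA; exact: fin_num_measure.
pose V : set R := [set fine (P A) | A in [set A | measurable A /\ mu A = 0%E]].
have Vsup : has_sup V.
  split; first by exists (fine (P set0)), set0.
  exists 1 => _ [A [mA _] <-]; rewrite -lee_fin fineK ?Pfin //; exact: probability_le1.
have choice n : exists A, [/\ measurable A, mu A = 0%E & sup V - n.+1%:R^-1 <= fine (P A)].
  have n0 : 0 < n.+1%:R^-1 :> R by rewrite invr_gt0.
  have [_ [A [mA A0] <-] h] := sup_adherent n0 Vsup.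
  by exists A; split=> //; exact: ltW.
pose Z n := sval (cid (choice n)).
have mZ n : measurable (Z n) by rewrite /Z; case: cid => ? [].
have Z0 n : mu (Z n) = 0%E by rewrite /Z; case: cid => ? [].
have ZP n : sup V - n.+1%:R^-1 <= fine (P (Z n)) by rewrite /Z; case: cid => ? [].
pose U := \bigcup_n Z n.
have mU : measurable U by exact: bigcup_measurable.
have U0 : mu U = 0%E by exact: null_bigcup.
have supU : sup V <= fine (P U).
  apply/ler_addgt0Pr => e e0.
  have [n hn] : exists n, n.+1%:R^-1 < e.
    exists (Num.truncn e^-1); rewrite invf_plt ?posrE //; exact: Num.Theory.truncnS_gt.
  have : fine (P (Z n)) <= fine (P U).
    rewrite fine_le ?Pfin // le_measure ?inE //; exact: bigcup_sup.
  move=> h; have := ZP n; rewrite lerBlDr => /le_trans; apply; apply: lerD => //; exact: ltW.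
exists U; split=> // A mA A0.
have mAU : measurable (A `\` U) by exact: measurableD.
have mAuU : measurable (U `|` (A `\` U)) by exact: measurableU.
have : fine (P (U `|` (A `\` U))) <= sup V.
  apply: (sup_upper_bound Vsup); exists (U `|` (A `\` U)) => //; split=> //.
  apply/eqP; rewrite eq_le measure_ge0 andbT.
  have -> : U `|` (A `\` U) = A `|` U.
    apply/seteqP; split=> x /=; first by move=> [?|[? _]]; [right|left].
    by move=> [Ax|Ux]; [have [?|?] := pselect (U x); [left|right]|left].
  have : (mu (A `|` U) <= mu A + mu U)%E by exact: measureU2.
  by rewrite A0 U0 adde0.
rewrite measureU //; last by apply/seteqP; split=> x //= -[Ux [_]].
rewrite fineD ?Pfin // => h.
apply/eqP; rewrite -fine_eq0 ?Pfin //; apply/eqP.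
have : 0 <= fine (P (A `\` U)) by rewrite fine_ge0.
lra.
Qed.

Lemma sigma_finite_pos_set : sigma_finite setT mu -> mu setT != 0%E ->
  exists F, [/\ measurable F, (0 < mu F)%E & (mu F < +oo)%E].
Proof.
move=> [F TF mF] mu0.
have [[n hn]|h] := pselect (exists n, mu (F n) != 0%E).
  by exists (F n); have [? ?] := mF n; split=> //; rewrite lt_neqAle eq_sym hn measure_ge0.
exfalso; move/eqP: mu0; apply; rewrite TF; apply: null_bigcup => n.
  by have [] := mF n.
by apply/eqP/negPn/negP => hn; apply: h; exists n.
Qed.

End AbsoluteContinuity.

Section SigmaFiniteMeasure.
Context (d : measure_display) (X : measurableType d) (R : realType).

(** A named copy of mu, which can carry the structure of a sigma-finite
    measure. *)
Definition as_sigma_finite (mu : {measure set X -> \bar R})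
  (mu_sfinite : sigma_finite setT mu) : set X -> \bar R := mu.

Context (mu : {measure set X -> \bar R}) (mu_sfinite : sigma_finite setT mu).

HB.instance Definition _ := Measure.on (as_sigma_finite mu_sfinite).
HB.instance Definition _ := Measure_isSigmaFinite.Build _ _ _
  (as_sigma_finite mu_sfinite) mu_sfinite.

End SigmaFiniteMeasure.

Section DensityFromEstimate.
Context (d : measure_display) (X : measurableType d) (R : realType).
Context (mu : {measure set X -> \bar R}) (q s : R) (q0 : 0 < q) (lt_qs : q < s).
Context (mu_sfinite : sigma_finite setT mu) (mu_neq0 : mu setT != 0%E).
Context (Y : lmodType R) (N : Y -> R).
Context (T : (X -> R) -> Y) (T_bl : is_bounded_linear mu s N T).

Let s0 : 0 < s. Proof. exact: lt_trans lt_qs. Qed.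

Let th0 : 0 < q^-1 - s^-1.
Proof. by rewrite subr_gt0 ltf_pV2 ?posrE. Qed.

(** On mu-null sets T vanishes, so P may be restricted to the complement of
    a maximal null set Z and then has a Radon-Nikodym density f. Since this
    restriction may be 0, the normalized indicator of a set F of positive
    finite measure is added before normalizing to integral 1. *)
Lemma set_bound_density (P : probability X R) C : 0 < C -> set_bound mu q s N T P C ->
  exists (w : X -> R) (C' : R), [/\ 0 < C', mu.-integrable setT (EFin \o w),
    forall x, 0 <= w x, (\int[mu]_x (w x)%:E = 1)%E &
    set_bound mu q s N T (weighted mu w) C'].
Proof.
move=> C0 hC.
have [Z [mZ Z0 Zmax]] := maximal_null_set mu P.
have mZC : measurable (~` Z) by exact: measurableC.
have PZfin : (P (~` Z) < +oo)%E.
  by rewrite -ge0_fin_numE ?measure_ge0 //; exact: fin_num_measure.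
pose nu : {finite_measure set X -> \bar R} := mfrestr mZC PZfin.
pose mu' : {sigma_finite_measure set X -> \bar R} := as_sigma_finite mu_sfinite.
have numu : nu `<< mu'.
  apply/null_content_dominatesP => A mA A0.
  rewrite /nu /= /mfrestr /mrestr -setDE; exact: Zmax.
have [f [f0 ffin fint fE]] := radon_nikodym_sigma_finite numu.
have [F [mF F0 Foo]] := sigma_finite_pos_set mu_sfinite mu_neq0.
have Ffin : mu F \is a fin_num by rewrite ge0_fin_numE // measure_ge0.
have F0' : 0 < fine (mu F) by rewrite fine_gt0 // F0.
have mT : nu setT \is a fin_num by exact: fin_num_measure.
pose m := fine (nu setT); have m0 : 0 <= m by rewrite fine_ge0.
have m1 : 0 < m + 1 by rewrite ltr_wpDl.
pose w x := (m + 1)^-1 * (fine (f x) + (fine (mu F))^-1 * \1_F x).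
have i1F : mu.-integrable setT (fun x => (\1_F x)%:E).
  apply/integrableP; split; first by apply/measurable_EFinP; exact: measurable_indic.
  rewrite (eq_integral (fun x => (\1_F x)%:E)) ?integral_indic ?setIT // => x _.
  by rewrite gee0_abs // lee_fin.
have iF : mu.-integrable setT (EFin \o (fun x => (fine (mu F))^-1 * \1_F x)).
  rewrite (_ : _ \o _ = (fun x => ((fine (mu F))^-1)%:E * (\1_F x)%:E)%E) //.
  exact: integrableZl.
have intf : (\int[mu]_x f x = m%:E)%E by rewrite /m fineK // fE.
have wE x : ((w x)%:E = ((m + 1)^-1)%:E * (f x + ((fine (mu F))^-1 * \1_F x)%:E))%E.
  by rewrite /w EFinM EFinD fineK.
have isum : mu.-integrable setT (fun x => f x + ((fine (mu F))^-1 * \1_F x)%:E)%E.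
  exact: (integrableD measurableT fint iF).
have wint : mu.-integrable setT (EFin \o w).
  rewrite (_ : _ \o _ = (fun x => ((m + 1)^-1)%:E * (f x + ((fine (mu F))^-1 * \1_F x)%:E))%E).
    exact: integrableZl.
  by apply/funext => x /=; rewrite wE.
have w0 x : 0 <= w x.
  rewrite /w; apply: mulr_ge0; first by rewrite invr_ge0 ltW.
  apply: addr_ge0; first exact: fine_ge0.
  by apply: mulr_ge0 => //; rewrite invr_ge0 ltW.
exists w, (C * (m + 1) `^ (q^-1 - s^-1)); split=> //.
- by rewrite mulr_gt0 // powR_gt0.
- rewrite (eq_integral _ _ (fun x _ => wE x)) integralZl // integralD //.
  rewrite intf (eq_integral (fun x => ((fine (mu F))^-1)%:E * (\1_F x)%:E)%E) //.
  rewrite integralZl //.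
  rewrite integral_indic // setIT -(fineK Ffin) -!EFinM mulVf ?gt_eqF //.
  by rewrite mulVf // gt_eqF.
move=> g E gL mE.
have mEZ : measurable (E `\` Z) by exact: measurableD.
have -> : T (cutoff g E) = T (cutoff g (E `\` Z)).
  have [Tae _ _] := T_bl; apply: Tae.
  - by have [] := Lfun_cutoff s0 gL mE.
  - by have [] := Lfun_cutoff s0 gL mEZ.
  - exists Z; split=> // x /= h; apply: contrapT => xZ; apply: h.
    rewrite /cutoff !indicE; congr (_ * (nat_of_bool _)%:R).
    by apply/idP/idP => /set_mem h; apply/mem_set; [split|case: h].
apply: le_trans (hC g _ gL mEZ) _.
have [Wfin W0] := (finite_monotone_weighted wint w0).1 E mE.
rewrite -!mulrA ler_wpM2l ?(ltW C0) // [leRHS]mulrCA ler_wpM2l ?Lsnorm_ge0 //.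
have W0' : 0 <= fine (weighted mu w E) by rewrite fine_ge0.
rewrite -(powRM _ (ltW m1) W0').
have PEfin : P (E `\` Z) \is a fin_num by exact: fin_num_measure.
apply: ge0_ler_powR; rewrite ?nnegrE ?(ltW th0) ?fine_ge0 ?mulr_ge0 ?(ltW m1) //.
rewrite -lee_fin EFinM !fineK //.
have -> : P (E `\` Z) = (\int[mu]_(x in E) f x)%E by rewrite -[RHS]fE // setDE.
rewrite /weighted -ge0_integralZl //=.
- apply: ge0_le_integral_nonmeasurable => x _; first exact: f0.
  rewrite -EFinM /w mulrA divff ?gt_eqF // mul1r EFinD fineK // leeDl //.
- apply: measurable_funTS; by have /integrableP[] := wint.
- by move=> x _; rewrite lee_fin.
- by rewrite lee_fin ltW.
Qed.

End DensityFromEstimate.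

(** * The equivalence *)

Unset Implicit Arguments.

Theorem theorem4p2 (R : realType) (r q s t : R)
    (r_gt0 : 0 < r) (le_rq : r <= q) (lt_qs : q < s) (r_le1 : r <= 1)
    (t_def : t^-1 = q^-1 - s^-1)
    (d : measure_display) (X : measurableType d)
    (mu : {measure set X -> \bar R})
    (mu_sfinite : sigma_finite setT mu) (mu_neq0 : mu setT != 0%E)
    (Y : lmodType R) (N : Y -> R) (rBanachY : is_r_Banach r N)
    (T : (X -> R) -> Y) (T_bl : is_bounded_linear mu s N T) :
  [<-> upper_estimate mu N T q s;
       set_estimate mu N T q s;
       multiplier_estimate mu N T r s t;
       factorization mu N T q r s].
Proof.
have q0 : 0 < q by exact: lt_le_trans le_rq.
have s0 : 0 < s by exact: lt_trans lt_qs.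
tfae.
- move=> /(upper_set_bound q0 lt_qs r_gt0 rBanachY T_bl)[C [P [C0 hC]]].
  exact: (set_bound_estimate q0 lt_qs C0 hC).
- move=> /(set_estimate_bound q0 lt_qs)[C [P [C0 hC]]].
  have [C' C'0 hC'] := set_bound_multiplier q0 lt_qs r_gt0 rBanachY T_bl t_def C0
    (finite_monotone_probability P) hC.
  by exists C', P; split.
- move=> /(multiplier_set_estimate q0 lt_qs r_gt0 t_def)/(set_estimate_bound q0 lt_qs).
  move=> [C [P [C0 hC]]].
  have [w [C1 [C10 wint w0 w1 hw]]] :=
    set_bound_density q0 lt_qs mu_sfinite mu_neq0 T_bl C0 hC.
  have [C2 C20 h2] := set_bound_factorization q0 lt_qs r_gt0 rBanachY T_bl wint w0 C10 hw.
  by exists C2, w; split.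
- move=> [C [w [C0 [wint w0 w1 hC]]]].
  have [C1 C10 h1] := factorization_set_bound q0 lt_qs r_gt0 T_bl wint w0 C0 hC.
  have [wfin wmon] := finite_monotone_weighted wint w0.
  apply: (set_bound_upper q0 lt_qs rBanachY T_bl C10 _ _ h1); last first.
    by move=> A mA; have [_ ?] := wfin A mA; rewrite fine_ge0.
  move=> n A mA dA.
  have mw : measurable_fun setT (EFin \o w) by have /integrableP[] := wint.
  rewrite -lee_fin -sumEFin -w1.
  rewrite (eq_bigr (fun i => \int[mu]_(x in A i) (w x)%:E)%E); last first.
    by move=> i _; rewrite fineK //; have [] := wfin _ (mA i).
  rewrite -ge0_integral_bigsetU //=.
  + apply: ge0_subset_integral => //; first exact: bigsetU_measurable.
    by move=> x _; rewrite lee_fin.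
  + exact: index_enum_uniq.
  + by apply/trivIsetP => i j _ _ ij; exact: dA.
  + exact: measurable_funTS.
  + by move=> x _; rewrite lee_fin.
Qed.
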